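(* Let $R$ be an arbitrary (associative and commutative) radically Noetherian domain containing the field of rational numbers $\mathbb{Q}=\mathbb{Q}\cdot 1\subseteq R$, and let $m\ge1$. Then every free algebra over $R$ of the variety $\mathrm{Var}(P_m)$ is equationally Noetherian.
   Context: $R$ has identity; it is radically Noetherian if it satisfies the ascending chain condition on radical (radically closed) ideals. $P_m$ (the symplectic Poisson algebra of index $m$ over $R$) is the polynomial algebra $R[x_1,\ldots,x_{2m}]$ with its usual multiplication and the bracket $$\{f,g\}=\sum_{i=1}^m\Bigl(\frac{\partial f}{\partial x_{2i-1}}\frac{\partial g}{\partial x_{2i}}-\frac{\partial f}{\partial x_{2i}}\frac{\partial g}{\partial x_{2i-1}}\Bigr).$$ $\mathrm{Var}(P_m)$ is the variety of (Poisson) algebras over $R$ generated by $P_m$. Equationally Noetherian: let $A$ be a Poisson algebra over $R$ and $\mathfrak{M}$ a variety of Poisson algebras over $R$ with $A\in\mathfrak{M}$. For $k\ge 1$ let $\mathfrak{M}\langle z_1,\ldots,z_k\rangle$ be the free algebra of $\mathfrak{M}$ on $z_1,\ldots,z_k$, and let $D=A\sqcup_{\mathfrak{M}}\mathfrak{M}\langle z_1,\ldots,z_k\rangle$ be the coproduct in $\mathfrak{M}$ (only varieties for which both canonical maps into $D$ are injective are considered). For $f\in D$ and $(a_1,\ldots,a_k)\in A^k$ put $f(a_1,\ldots,a_k)=\phi(f)$, where $\phi:D\to A$ is the unique homomorphism that is the identity on $A$ and sends $z_i$ to $a_i$. For $S\subseteq D$ put $Z(S)=\{a\in A^k : f(a)=0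 \text{ for all } f\in S\}$. The sets $Z(S)$ define (as a subbasis of closed sets) the Zariski topology on $A^k$. $A$ is equationally Noetherian if $A^k$ is a Noetherian topological space for every $k\ge1$; equivalently, for every $k$ and every $S\subseteq D$ there is a finite $S_0\subseteq S$ with $Z(S)=Z(S_0)$. This does not depend on the choice of $\mathfrak{M}$ containing $A$ (one may take the variety generated by $A$). *)

(* Defs.v *)
From HB Require Import structures.
From mathcomp Require Import all_boot all_order all_algebra.
From mathcomp Require Import boolp classical_sets topology_structure.
From mathcomp Require Import ring.
From mathcomp Require Import -(notations) mpoly.

Set Implicit Arguments.
Unset Strict Implicit.
Unset Printing Implicit Defensive.

Import GRing.Theory.

Local Open Scope classical_set_scope.
Local Open Scope ring_scope.

Definition radical_ideal (R : comNzRingType) (I : set R) : Prop :=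
  [/\ I 0,
      forall x y, I x -> I y -> I (x + y),
      forall r x, I x -> I (r * x)
    & forall x n, I (x ^+ n) -> I x].

Definition radically_noetherian (R : comNzRingType) : Prop :=
  forall I : nat -> set R,
    (forall n, radical_ideal (I n)) -> (forall n, I n `<=` I n.+1) ->
    exists N, forall n, (N <= n)%N -> I n = I N.

HB.mixin Record hasPoissonBracket (R : comNzRingType) A
    of GRing.ComPzRing A & GRing.SemiAlgebra R A := {
  brk : A -> A -> A;
  brkDZl : forall (r : R) a b c, brk (r *: a + b) c = r *: brk a c + brk b c;
  brkxx : forall a, brk a a = 0;
  brk_jacobi : forall a b c,
    brk a (brk b c) + brk b (brk c a) + brk c (brk a b) = 0;
  brk_leibniz : forall a b c, brk a (b * c) = brk a b * c + b * brk a c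
}.

(* The underlying rings are unital, but not assumed nonzero, so that a variety *)
(* contains the zero algebra (which comAlgType would exclude).                 *)
#[short(type="poissonAlgType")]
HB.structure Definition PoissonAlgebra (R : comNzRingType) :=
  {A of GRing.ComPzRing A & GRing.Lmodule R A & GRing.SemiAlgebra R A
      & hasPoissonBracket R A}.

HB.mixin Record isPoissonMorphism (R : comNzRingType)
    (A B : poissonAlgType R) (f : A -> B) := {
  brk_morph : {morph f : a b / brk a b >-> brk a b}
}.

HB.structure Definition PoissonMorphism (R : comNzRingType)
    (A B : poissonAlgType R) :=
  {f of @GRing.LRMorphism R A B *:%R f & isPoissonMorphism R A B f}.

Notation "{ 'poisson' A -> B }" := (PoissonMorphism.type A B)
  (at level 0, A at level 98, B at level 99,
   format "{ 'poisson'  A  ->  B }") : type_scope.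

Section Symplectic.
Variables (R : comNzRingType) (m : nat).

Definition symplectic : Type := mpoly m.*2 R.

HB.instance Definition _ := GRing.ComAlgebra.on symplectic.

(* With indices starting at 0, the variables x_(2i-1) and x_(2i), 1 <= i <= m, *)
(* are those of indices 2i and 2i+1, i < m.                                    *)
Lemma even_index_subproof (i : 'I_m) : (i.*2 < m.*2)%N.
Proof. by rewrite ltn_double. Qed.
Lemma odd_index_subproof (i : 'I_m) : (i.*2.+1 < m.*2)%N.
Proof. by rewrite ltn_Sdouble. Qed.
Definition even_index (i : 'I_m) : 'I_m.*2 := Ordinal (even_index_subproof i).
Definition odd_index (i : 'I_m) : 'I_m.*2 := Ordinal (odd_index_subproof i).

Definition partial (i : 'I_m.*2) : symplectic -> symplectic := mderiv i.

Lemma partial_linear i : linear (partial i).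
Proof. exact: mderiv_is_linear. Qed.

HB.instance Definition _ i :=
  GRing.isLinear.Build R symplectic symplectic _ (partial i)
    (partial_linear i).

Lemma partialM i f g : partial i (f * g) = partial i f * g + f * partial i g.
Proof. exact: mderivM. Qed.

Lemma partialC i j f : partial i (partial j f) = partial j (partial i f).
Proof. exact: mderiv_comm. Qed.

Definition symplectic_brk (f g : symplectic) : symplectic :=
  \sum_(i < m) (partial (even_index i) f * partial (odd_index i) g
                - partial (odd_index i) f * partial (even_index i) g).

Lemma symplectic_brkDZl (r : R) a b c :
  symplectic_brk (r *: a + b) c
  = r *: symplectic_brk a c + symplectic_brk b c.
Proof.
rewrite /symplectic_brk scaler_sumr -big_split /=; apply: eq_bigr => i _.
by rewrite !linearP !mulrDl -!scalerAl opprD scalerBr addrACA.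
Qed.

Lemma symplectic_brkxx a : symplectic_brk a a = 0.
Proof. by rewrite /symplectic_brk big1 // => i _; rewrite mulrC subrr. Qed.

Lemma symplectic_brk_leibniz a b c :
  symplectic_brk a (b * c) = symplectic_brk a b * c + b * symplectic_brk a c.
Proof.
rewrite /symplectic_brk mulr_suml mulr_sumr -big_split /=.
by apply: eq_bigr => i _; rewrite !partialM; ring.
Qed.

Lemma symplectic_brk_jacobi a b c :
  symplectic_brk a (symplectic_brk b c) + symplectic_brk b (symplectic_brk c a)
  + symplectic_brk c (symplectic_brk a b) = 0.
Proof.
pose p i := partial (even_index i); pose q i := partial (odd_index i).
pose G f g h i j : symplectic :=
  p i f * q i (p j g) * q j h - p i f * q i (q j g) * p j h
  - q i f * p i (p j g) * q j h + q i f * p i (q j g) * p j h.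
have brkG f g h : symplectic_brk f (symplectic_brk g h) =
    \sum_i \sum_j G f g h i j - \sum_i \sum_j G f h g i j.
  rewrite -sumrB {1}/symplectic_brk; apply: eq_bigr => i _.
  rewrite -[RHS]sumrB /symplectic_brk !raddf_sum /= !mulr_sumr -sumrB.
  by apply: eq_bigr => j _; rewrite !raddfB /= !partialM /G /p /q; ring.
have swapG f g h : \sum_i \sum_j G f g h i j = \sum_i \sum_j G h g f i j.
  rewrite exchange_big; apply: eq_bigr => i _; apply: eq_bigr => j _.
  rewrite /G /p /q (partialC (even_index j) (even_index i)).
  rewrite (partialC (even_index j) (odd_index i)).
  rewrite (partialC (odd_index j) (even_index i)).
  by rewrite (partialC (odd_index j) (odd_index i)); ring.
by rewrite !brkG (swapG a b c) (swapG a c b) (swapG b a c); ring.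
Qed.

HB.instance Definition _ := hasPoissonBracket.Build R symplectic
  symplectic_brkDZl symplectic_brkxx symplectic_brk_jacobi
  symplectic_brk_leibniz.

End Symplectic.

Section MorphismInstances.
Variables (R : comNzRingType) (A B C : poissonAlgType R).
Variables (g : {poisson B -> C}) (f : {poisson A -> B}).

HB.instance Definition _ :=
  isPoissonMorphism.Build R A A idfun (fun _ _ => erefl).

Lemma comp_brk_morph : {morph g \o f : a b / brk a b >-> brk a b}.
Proof. by move=> a b /=; rewrite !brk_morph. Qed.

HB.instance Definition _ :=
  isPoissonMorphism.Build R A C (g \o f) comp_brk_morph.

End MorphismInstances.

(* Elements of the absolutely free algebra, over the variables V, in the       *)
(* signature of unital Poisson R-algebras (0 and opposites arise by scaling).  *)
Inductive pterm (R V : Type) : Type :=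
  | PVar of V
  | POne
  | PAdd of pterm R V & pterm R V
  | PScale of R & pterm R V
  | PMul of pterm R V & pterm R V
  | PBrk of pterm R V & pterm R V.

Arguments POne {R V}.

Section Varieties.
Variable R : comNzRingType.
Implicit Types (A B F D : poissonAlgType R) (M : poissonAlgType R -> Prop).

Fixpoint peval V A (v : V -> A) (t : pterm R V) : A :=
  match t with
  | PVar i => v i
  | POne => 1
  | PAdd t1 t2 => peval v t1 + peval v t2
  | PScale r t1 => r *: peval v t1
  | PMul t1 t2 => peval v t1 * peval v t2
  | PBrk t1 t2 => brk (peval v t1) (peval v t2)
  end.

Definition identity_of A (t : pterm R nat) : Prop :=
  forall v : nat -> A, peval v t = 0.

Definition is_variety M : Prop :=
  exists T : set (pterm R nat), forall A, M A <-> T `<=` identity_of A.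

Definition Var A : poissonAlgType R -> Prop :=
  fun B => identity_of A `<=` identity_of B.

Lemma Var_is_variety A : is_variety (Var A).
Proof. by exists (identity_of A). Qed.

Lemma Var_gen A : Var A A.
Proof. by []. Qed.

Lemma Var_min A M : is_variety M -> M A -> forall B, Var A B -> M B.
Proof.
by move=> [T MT] /MT TA B AB; apply/MT; apply: subset_trans TA AB.
Qed.

Definition is_free M (X : Type) F (x : X -> F) : Prop :=
  M F /\ forall B, M B -> forall g : X -> B,
    exists phi : {poisson F -> B},
      (forall i, phi (x i) = g i) /\
      forall psi : {poisson F -> B},
        (forall i, psi (x i) = g i) -> psi =1 phi.

Definition is_coproduct M A F D
    (iA : {poisson A -> D}) (iF : {poisson F -> D}) : Prop :=
  M D /\ forall B, M B -> forall (g : {poisson A -> B}) (h : {poisson F -> B}),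
    exists phi : {poisson D -> B},
      [/\ forall a, phi (iA a) = g a, forall f, phi (iF f) = h f &
      forall psi : {poisson D -> B},
        (forall a, psi (iA a) = g a) -> (forall f, psi (iF f) = h f) ->
        psi =1 phi].

End Varieties.

Section Zariski.
Variables (R : comNzRingType) (k : nat) (A D : poissonAlgType R).
Variables (iA : {poisson A -> D}) (z : 'I_k -> D).

Definition is_evaluation (a : {ffun 'I_k -> A}) (phi : {poisson D -> A}) :=
  (forall c, phi (iA c) = c) /\ (forall i, phi (z i) = a i).

(* When D is the coproduct of A and the free algebra on the z_i, there is a    *)
(* unique evaluation phi at a; f(a) is phi f.                                  *)
Definition zero_locus (S : set D) : set {ffun 'I_k -> A} :=
  [set a | exists2 phi, is_evaluation a phi & forall f, S f -> phi f = 0].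

End Zariski.

(* A^k with the topology for which the zero loci are a subbasis of closed sets *)
Definition zariski_space (R : comNzRingType) (k : nat)
    (A D : poissonAlgType R) (iA : {poisson A -> D}) (z : 'I_k -> D) : Type :=
  {ffun 'I_k -> A}.

Section ZariskiTopology.
Variables (R : comNzRingType) (k : nat) (A D : poissonAlgType R).
Variables (iA : {poisson A -> D}) (z : 'I_k -> D).

HB.instance Definition _ := Choice.on (zariski_space iA z).
HB.instance Definition _ := isSubBaseTopological.Build (zariski_space iA z)
  [set: set D] (fun S => ~` zero_locus iA z S).

End ZariskiTopology.

Lemma evaluation_exists_unique (R : comNzRingType) (k : nat)
    (M : poissonAlgType R -> Prop) (A F D : poissonAlgType R) (z : 'I_k -> F)
    (iA : {poisson A -> D}) (iF : {poisson F -> D}) (a : {ffun 'I_k -> A}) :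
  M A -> is_free M z -> is_coproduct M iA iF ->
  exists phi, is_evaluation iA (iF \o z) a phi /\
    forall psi, is_evaluation iA (iF \o z) a psi -> psi =1 phi.
Proof.
move=> MA [_ freeF] [_ copD]; have [h [hz huniq]] := freeF A MA a.
have [phi [phiA phiF phi_uniq]] := copD A MA idfun h.
exists phi; split; first by split=> [//|i] /=; rewrite phiF.
move=> psi [psiA psiz]; apply: phi_uniq => // f.
by rewrite -[LHS]/((psi \o iF) f); apply: huniq.
Qed.

Definition noetherian_space (T : topologicalType) : Prop :=
  forall C : nat -> set T,
    (forall n, closed (C n)) -> (forall n, C n.+1 `<=` C n) ->
    exists N, forall n, (N <= n)%N -> C n = C N.

Section EquationallyNoetherian.
Variable R : comNzRingType.
Implicit Types (A F D : poissonAlgType R) (M : poissonAlgType R -> Prop).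

Definition admissible M A : Prop :=
  [/\ is_variety M, M A &
  forall k, (0 < k)%N ->
  forall F (z : 'I_k -> F), is_free M z ->
  forall D (iA : {poisson A -> D}) (iF : {poisson F -> D}),
    is_coproduct M iA iF -> injective iA /\ injective iF].

(* Free algebras and coproducts are determined up to isomorphism; the property *)
(* is required of all of them, and for all admissible varieties.               *)
Definition equationally_noetherian A : Prop :=
  forall M, admissible M A ->
  forall k, (0 < k)%N ->
  forall F (z : 'I_k -> F), is_free M z ->
  forall D (iA : {poisson A -> D}) (iF : {poisson F -> D}),
    is_coproduct M iA iF -> noetherian_space (zariski_space iA (iF \o z)).

End EquationallyNoetherian.

(* Main.v *)
(* The free algebra F embeds in the product of copies of P_m indexed by its   *)
(* homomorphisms to P_m, and any two nonzero elements of F survive under a    *)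
(* common homomorphism (move along the line joining two assignments of the    *)
(* generators). Hence the sets {phi | phi f <> 0}, f <> 0, lie in an          *)
(* ultrafilter, and modulo this ultrafilter F sits in a differential domain   *)
(* whose derivations induce the bracket. Poisson equations over F thereby     *)
(* become differential polynomial equations, and the Ritt-Raudenbush basis    *)
(* theorem makes the Zariski topology Noetherian. To avoid forming quotients  *)
(* and fraction fields, the theorem is proved for ideals saturated with       *)
(* respect to the constants that do not vanish modulo the ultrafilter.        *)
Require Import Defs.
From HB Require Import structures.
From mathcomp Require Import all_boot all_order all_algebra.
From mathcomp Require Import finmap.
From mathcomp Require Import boolp classical_sets functions filter.
From mathcomp Require Import topology_structure.
From mathcomp Require Import ring zify.
From mathcomp Require Import -(notations) mpoly.

Set Implicit Arguments.
Unset Strict Implicit.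
Unset Printing Implicit Defensive.

Import Order.TTheory GRing.Theory Num.Theory.

Local Open Scope classical_set_scope.
Local Open Scope ring_scope.

(** * The Ritt-Raudenbush basis theorem *)

(** Let F be the free algebra, P the symplectic algebra and D the coproduct holding the equations
    over F. For d in D, a point a of F^k and a homomorphism phi from F to P, phi(d(a)) is a
    differential polynomial in phi(a_1), ..., phi(a_k) with coefficients depending only on phi
    ([evaluation_diff_poly]). Along the ultrafilter of [generic_ultrafilter], d(a) = 0 exactly when
    phi(d(a)) = 0 for almost all phi. A descending chain of closed sets gives an ascending chain of
    radical differential ideals, which stabilises ([diff_loci_noetherian]); a point off a closed set
    is separated from it by a single d ([zariski_closed_separated]), so the closed sets stabilise
    too.

    The chain condition is the Ritt-Raudenbush theorem. An ideal maximal among those without finite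
    basis is prime. By Dickson's lemma the algebraic leaders of a prime ideal are derivatives of
    finitely many; reduction by the corresponding elements shows that some h outside the ideal
    multiplies it into a finitely generated one ([prime_finite_colon]). By maximality the ideal is
    also finitely based once h is adjoined, and the two facts yield a finite basis
    ([closed_ideal_finitely_based]). *)

Section RittRaudenbush.
Variables (B : comNzRingType) (I : Type) (V : eqType).
Variables (der : I -> B -> B) (K K0 : set B) (v : V -> B).
Variables (shift : I -> V -> V) (lt : V -> V -> Prop).

(** Differential polynomials are elements of an ambient ring in which the [v w] may satisfy
    relations, so that functions can replace formal polynomials. *)
Inductive genring (U : set V) : B -> Prop :=
  | genring_coef c of K c : genring U c
  | genring_var w of U w : genring U (v w)
  | genringD f g of genring U f & genring U g : genring U (f + g)
  | genringM f g of genring U f & genring U g : genring U (f * g).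

Local Notation Bv := (genring setT).

(* Radical differential ideals of the subring [genring setT] that contain [K0]
   and are saturated with respect to [K] minus [K0]: when K / K0 is a domain,
   these are the traces of the radical differential ideals over its fraction
   field. *)
Record closed_ideal (P : set B) : Prop := ClosedIdeal {
  ci_sub : P `<=` Bv;
  ci_null : K0 `<=` P;
  ciD : forall f g, P f -> P g -> P (f + g);
  ciM : forall b f, Bv b -> P f -> P (b * f);
  ci_rad : forall f n, Bv f -> P (f ^+ n) -> P f;
  ci_der : forall i f, P f -> P (der i f);
  ci_sat : forall c f, Bv f -> K c -> ~ K0 c -> P (c * f) -> P f
}.

Inductive gen (S : set B) : B -> Prop :=
  | gen_base f of S f : gen S f
  | gen_null f of K0 f : gen S f
  | genD f g of gen S f & gen S g : gen S (f + g)
  | genM b f of Bv b & gen S f : gen S (b * f)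
  | gen_rad f n of Bv f & gen S (f ^+ n) : gen S f
  | gen_der i f of gen S f : gen S (der i f)
  | gen_sat c f of Bv f & K c & ~ K0 c & gen S (c * f) : gen S f.

Inductive reach (L : seq V) : V -> Prop :=
  | reach0 w of w \in L : reach L w
  | reachS i w of reach L w : reach L (shift i w).

Hypothesis derD : forall i, {morph der i : f g / f + g}.
Hypothesis derM : forall i f g, der i (f * g) = der i f * g + f * der i g.
Hypothesis derv : forall i w, der i (v w) = v (shift i w).
Hypothesis KD : forall a b, K a -> K b -> K (a + b).
Hypothesis KM : forall a b, K a -> K b -> K (a * b).
Hypothesis Kder : forall i a, K a -> K (der i a).
Hypothesis KN1 : K (- 1).
(** Characteristic zero, which keeps separants out of prime ideals. *)
Hypothesis Kinv : forall n : nat, exists2 u, K u & u * n.+1%:R = 1.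
Hypothesis K0K : K0 `<=` K.
Hypothesis K0_0 : K0 0.
(** [lt] is a ranking of the derivatives in the sense of Ritt. *)
Hypothesis ltwf : well_founded lt.
Hypothesis lt_trans : forall u w z, lt u w -> lt w z -> lt u z.
Hypothesis lt_total : forall u w, [\/ lt u w, u = w | lt w u].
Hypothesis lt_shift : forall i u w, lt u w -> lt (shift i u) (shift i w).
Hypothesis shift_lt : forall i w, lt w (shift i w).
(** This makes characteristic sets finite. *)
Hypothesis dickson : forall E : set V,
  (forall i w, E w -> E (shift i w)) ->
  exists2 L, {in L, forall w, E w} & E `<=` reach L.

(** * Subrings generated by sets of derivatives *)

Lemma K1 : K 1.
Proof. by rewrite -[1]opprK -mulN1r; apply: KM => //. Qed.

Lemma Kr0 : K 0.
Proof. by rewrite -(subrr 1); apply: KD => //; apply: K1. Qed.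

Lemma genringr0 U : genring U 0. Proof. exact/genring_coef/Kr0. Qed.
Lemma genring1 U : genring U 1. Proof. exact/genring_coef/K1. Qed.

Lemma genringN U f : genring U f -> genring U (- f).
Proof. by rewrite -mulN1r; apply: genringM; apply: genring_coef. Qed.

Lemma genringX U f n : genring U f -> genring U (f ^+ n).
Proof.
by move=> Uf; elim: n => [|n IH]; rewrite ?expr0 ?exprS;
  [apply: genring1|apply: genringM].
Qed.

Lemma genring_mulrn U f n : genring U f -> genring U (f *+ n).
Proof.
by move=> Uf; elim: n => [|n IH]; rewrite ?mulr0n ?mulrS;
  [apply: genringr0|apply: genringD].
Qed.

Lemma genring_sum U (J : Type) (r : seq J) (Q : pred J) F :
  (forall j, Q j -> genring U (F j)) -> genring U (\sum_(j <- r | Q j) F j).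
Proof. by move=> H; apply: big_ind => //;
  [apply: genringr0|apply: genringD]. Qed.

Lemma sub_genring U U' : U `<=` U' -> genring U `<=` genring U'.
Proof.
move=> UU' f; elim=> {f}.
- exact: genring_coef.
- by move=> w /UU'; apply: genring_var.
- by move=> *; apply: genringD.
- by move=> *; apply: genringM.
Qed.

Lemma genring_der U U' i :
  U `<=` U' -> (forall w, U w -> U' (shift i w)) ->
  forall f, genring U f -> genring U' (der i f).
Proof.
move=> UU' sU f; elim=> {f}.
- by move=> c /(Kder i); apply: genring_coef.
- by move=> w /sU Uw; rewrite derv; apply: genring_var.
- by move=> *; rewrite derD; apply: genringD.
- move=> f g /(sub_genring UU') Uf IHf /(sub_genring UU') Ug IHg.
  by rewrite derM; apply: genringD; apply: genringM.
Qed.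

Definition poly_genring U (p : {poly B}) := forall i, genring U p`_i.

Lemma poly_genringD U p q : poly_genring U p -> poly_genring U q ->
  poly_genring U (p + q).
Proof. by move=> Up Uq i; rewrite coefD; apply: genringD. Qed.

Lemma poly_genringM U p q : poly_genring U p -> poly_genring U q ->
  poly_genring U (p * q).
Proof.
by move=> Up Uq i; rewrite coefM; apply: genring_sum => j _; apply: genringM.
Qed.

Lemma poly_genringC U c : genring U c -> poly_genring U c%:P.
Proof. by move=> Uc i; rewrite coefC; case: ifP => // _; apply: genringr0. Qed.

Lemma poly_genringX U : poly_genring U 'X.
Proof. by move=> i; rewrite coefX; case: eqP => _;
  [apply: genring1|apply: genringr0]. Qed.

Lemma poly_genringN U p : poly_genring U p -> poly_genring U (- p).
Proof. by move=> Up i; rewrite coefN; apply: genringN. Qed.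

Lemma poly_genringXn U n : poly_genring U 'X^n.
Proof. by move=> i; rewrite coefXn; case: eqP => _;
  [apply: genring1|apply: genringr0]. Qed.

Lemma genring_horner U p x : poly_genring U p -> genring U x -> genring U p.[x].
Proof.
move=> Up Ux; rewrite horner_coef; apply: genring_sum => j _.
by apply: genringM => //; apply: genringX.
Qed.

Lemma genring_poly U w f : genring (U `|` [set w]) f ->
  exists2 p, poly_genring U p & f = p.[v w].
Proof.
elim=> {f}.
- move=> c Kc; exists c%:P; last by rewrite hornerC.
  exact/poly_genringC/genring_coef.
- move=> u [Uu|->].
    by exists (v u)%:P; [apply/poly_genringC/genring_var|rewrite hornerC].
  by exists 'X; [apply: poly_genringX|rewrite hornerX].
- move=> f g _ [p Up ->] _ [q Uq ->].
  by exists (p + q); [apply: poly_genringD|rewrite hornerD].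
- move=> f g _ [p Up ->] _ [q Uq ->].
  by exists (p * q); [apply: poly_genringM|rewrite hornerM].
Qed.

Definition below w : set V := [set u | lt u w].

(** The larger of two leaders serves for a sum or product. It is only an upper bound, since [v w]
    may cancel. *)
Lemma genring_leader U f : genring U f ->
  K f \/ exists2 w, U w & genring (below w `|` [set w]) f.
Proof.
have belowS u w : lt u w -> below u `|` [set u] `<=` below w `|` [set w].
  by move=> uw z [zu|->]; left => //; apply: lt_trans uw.
have mono u w f0 : lt u w -> genring (below u `|` [set u]) f0 ->
    genring (below w `|` [set w]) f0 by move=> uw; apply/sub_genring/belowS.
have join (op : B -> B -> B) f1 f2 : (forall a b, K a -> K b -> K (op a b)) ->
    (forall W a b, genring W a -> genring W b -> genring W (op a b)) ->
    K f1 \/ (exists2 w, U w & genring (below w `|` [set w]) f1) ->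
    K f2 \/ (exists2 w, U w & genring (below w `|` [set w]) f2) ->
    K (op f1 f2) \/ exists2 w, U w & genring (below w `|` [set w]) (op f1 f2).
  move=> Kop Sop [K1'|[w1 U1 S1]] [K2|[w2 U2 S2]].
  - by left; apply: Kop.
  - by right; exists w2 => //; apply: Sop => //; apply: genring_coef.
  - by right; exists w1 => //; apply: Sop => //; apply: genring_coef.
  - right; case: (lt_total w1 w2) => [l12|e|l21].
    + by exists w2 => //; apply: Sop => //; apply: mono S1.
    + by subst w2; exists w1 => //; apply: Sop.
    + by exists w1 => //; apply: Sop => //; apply: mono S2.
elim=> {f}.
- by left.
- by move=> w Uw; right; exists w => //; apply: genring_var; right.
- by move=> f g _ IHf _ IHg; apply: (join +%R) IHf IHg;
    [exact: KD|exact: genringD].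
- by move=> f g _ IHf _ IHg; apply: (join *%R) IHf IHg;
    [exact: KM|exact: genringM].
Qed.

(** Chain rule, with the derivatives of the coefficients collected in [r]. *)
Lemma der_horner i (p : {poly B}) x : exists2 r : {poly B},
  forall j, r`_j = der i p`_j &
  der i p.[x] = p^`().[x] * der i x + r.[x].
Proof.
have der0 : der i 0 = 0.
  by apply: (addrI (der i 0)); rewrite -derD !addr0.
elim/poly_ind: p => [|p c [r rE hE]].
  by exists 0 => [j|]; rewrite ?coef0 ?deriv0 ?horner0 ?mul0r ?addr0 der0.
exists (r * 'X + (der i c)%:P).
  by case=> [|j]; rewrite !coefD !coefMX !coefC ?add0r ?addr0 /= ?rE.
rewrite hornerMXaddC derD derM hE derivMXaddC !(hornerD, hornerMX, hornerC).
move: (der i x) (der i c) p.[x] p^`().[x] r.[x] => *; ring.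
Qed.

(** * Radical differential ideals *)

Section Ideal.
Variable P : set B.
Hypothesis cP : closed_ideal P.

Lemma ciN f : P f -> P (- f).
Proof. by rewrite -mulN1r; apply: (ciM cP); apply: genring_coef. Qed.

Lemma ciB f g : P f -> P g -> P (f - g).
Proof. by move=> Pf /ciN; apply: (ciD cP). Qed.

Lemma ciMr b f : Bv b -> P f -> P (f * b).
Proof. by rewrite mulrC; apply: (ciM cP). Qed.

Lemma ci0 : P 0.
Proof. exact: (ci_null cP). Qed.

Lemma ci_sqr f : Bv f -> P (f * f) -> P f.
Proof. by move=> Bf; rewrite -expr2; apply: (ci_rad cP). Qed.

(** Radicality makes the colon differential: the square of der(f) t is a combination of f t and its
    derivative. *)
Lemma ci_colon t : Bv t -> closed_ideal [set f | Bv f /\ P (f * t)].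
Proof.
move=> Bt; split=> /=.
- by move=> f [].
- by move=> f K0f; split; [exact/genring_coef/K0K|apply: ciMr => //;
    apply: (ci_null cP)].
- move=> f g [Bf Pf] [Bg Pg]; split; first exact: genringD.
  by rewrite mulrDl; apply: (ciD cP).
- move=> b f Bb [Bf Pf]; split; first exact: genringM.
  by rewrite -mulrA; apply: (ciM cP).
(* The exponent n + 1 leaves a factor t even when n = 0. *)
- move=> f n Bf [_ Pf]; split=> //; apply: (ci_rad cP (n := n.+1));
    first exact: genringM.
  rewrite exprMn (_ : _ * _ = f * t ^+ n * (f ^+ n * t));
    last by rewrite !exprS; ring.
  by apply: (ciM cP) => //; apply: genringM => //; apply: genringX.
- move=> i f [Bf Pf]; have Bd g : Bv g -> Bv (der i g) by apply: genring_der.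
  split; first exact: Bd.
  have B1 := genringM (Bd f Bf) Bt; apply: ci_sqr => //.
  rewrite (_ : _ * _ = der i f * t * der i (f * t) - der i f * der i t * (f *
    t)).
    by apply: ciB; apply: (ciM cP) => //; [apply: (ci_der cP)|apply: genringM;
      apply: Bd].
  by rewrite derM; ring.
- move=> c f Bf Kc K0c [_ Pf]; split=> //.
  by apply: (ci_sat cP (c := c)) => //; [apply: genringM|rewrite mulrA].
Qed.

Lemma gen_min S : S `<=` P -> gen S `<=` P.
Proof.
move=> SP f; elim=> {f}.
- exact: SP.
- exact: (ci_null cP).
- by move=> *; apply: (ciD cP).
- by move=> *; apply: (ciM cP).
- by move=> f n Bf _; apply: (ci_rad cP).
- by move=> *; apply: (ci_der cP).
- by move=> c f Bf Kc K0c _; apply: (ci_sat cP).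
Qed.

End Ideal.

Lemma gen_closed S : S `<=` Bv -> closed_ideal (gen S).
Proof.
move=> SB; split.
- move=> f; elim=> {f} //.
  + by move=> f /K0K; apply: genring_coef.
  + by move=> *; apply: genringD.
  + by move=> *; apply: genringM.
  + by move=> i f _; apply: genring_der.
- exact: gen_null.
- exact: genD.
- exact: genM.
- exact: gen_rad.
- exact: gen_der.
- exact: gen_sat.
Qed.

Lemma sub_gen S S' : S `<=` S' -> gen S `<=` gen S'.
Proof.
move=> SS' f; elim=> {f}.
- by move=> f /SS'; apply: gen_base.
- exact: gen_null.
- by move=> *; apply: genD.
- by move=> *; apply: genM.
- by move=> f n Bf _; apply: gen_rad.
- by move=> *; apply: gen_der.
- by move=> c f Bf Kc K0c _; apply: gen_sat Kc K0c.
Qed.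

Lemma gen_finite S f : gen S f ->
  exists2 s : seq B, [set` s] `<=` S & gen [set` s] f.
Proof.
elim=> {f}.
- move=> f Sf; exists [:: f]; last by apply: gen_base; rewrite /= inE.
  by move=> g /=; rewrite inE => /eqP ->.
- by move=> f K0f; exists [::] => //; apply: gen_null.
- move=> f g _ [s sS sf] _ [s' s'S s'f]; exists (s ++ s').
    by move=> h /=; rewrite mem_cat => /orP [/sS|/s'S].
  apply: genD.
    by apply: sub_gen sf => h /= hs; rewrite mem_cat hs.
  by apply: sub_gen s'f => h /= hs; rewrite mem_cat hs orbT.
- by move=> b f Bb _ [s sS sf]; exists s => //; apply: genM.
- by move=> f n Bf _ [s sS sf]; exists s => //; apply: gen_rad sf.
- by move=> i f _ [s sS sf]; exists s => //; apply: gen_der.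
- by move=> c f Bf Kc K0c _ [s sS sf]; exists s => //; apply: gen_sat sf.
Qed.

(** Colon ideals by g, then by each element of [S], reduce the claim to generators. *)
Lemma gen_mul (P : set B) S T f g : closed_ideal P ->
  S `<=` Bv -> T `<=` Bv ->
  (forall a b, S a -> T b -> P (a * b)) -> gen S f -> gen T g -> P (f * g).
Proof.
move=> cP SB TB ST Sf Tg.
have Bg : Bv g by apply: (ci_sub (gen_closed TB)) Tg.
suff: (fun f => Bv f /\ P (f * g)) f by case.
apply: (gen_min (ci_colon cP Bg)) Sf => a Sa /=; split; first exact: SB.
rewrite mulrC; suff: (fun g => Bv g /\ P (g * a)) g by case.
apply: (gen_min (ci_colon cP (SB _ Sa))) Tg => b Tb /=; split; first exact: TB.
by rewrite mulrC; apply: ST.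
Qed.

(** * Characteristic sets of prime ideals *)

Section PrimeIdeal.
Variable P : set B.
Hypothesis cP : closed_ideal P.
Hypothesis P1 : ~ P 1.
Hypothesis Pprime : forall f g, Bv f -> Bv g -> P (f * g) -> P f \/ P g.

(** Modulo [P], the derivative [v w] is algebraic over the lower ones. *)
Definition algebraic w p :=
  [/\ poly_genring (below w) p, P p.[v w] & ~ P (lead_coef p)].

Definition cancellable (Q : set B) h :=
  Bv h /\ forall f, Bv f -> Q (f * h) -> Q f.

(* [q] plays the role of an element of a characteristic set of [P] with leader
   [v w]; its initial and separant are cancellable modulo [Q]. *)
Record reductor (Q : set B) w q : Prop := Reductor {
  red_genring : poly_genring (below w) q;
  red_in : Q q.[v w];
  red_init : cancellable Q (lead_coef q);
  red_sep : cancellable Q q^`().[v w];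
  red_min : forall p, algebraic w p -> (size q <= size p)%N
}.

Lemma genring_Bv U f : genring U f -> Bv f.
Proof. exact: sub_genring. Qed.

Lemma Bv_v w : Bv (v w). Proof. exact: genring_var. Qed.

Lemma poly_genring_lead U p : poly_genring U p -> genring U (lead_coef p).
Proof. by move=> Up; rewrite lead_coefE. Qed.

Lemma poly_genring_deriv U p : poly_genring U p -> poly_genring U p^`().
Proof. by move=> Up i; rewrite coef_deriv; apply: genring_mulrn. Qed.

Lemma algebraic_size w p : algebraic w p -> (1 < size p)%N.
Proof.
case=> _ Pp; apply: contra_notT; rewrite -leqNgt => /size1_polyC pE.
by move: Pp; rewrite {}pE hornerC lead_coefC.
Qed.

(** Take [q] of least degree. In characteristic zero its derivative has degree one less and an
    initial outside [P], so minimality keeps the separant outside [P]. *)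
Lemma algebraic_reductor w p : algebraic w p -> exists q, reductor P w q.
Proof.
move=> Ap; have [|n /asboolP[q Aq <-] nmin] :=
    @ex_minnP (fun n => `[< exists2 q, algebraic w q & size q = n >]).
  by exists (size p); apply/asboolP; exists p.
have qmin p' : algebraic w p' -> (size q <= size p')%N.
  by move=> Ap'; apply: nmin; apply/asboolP; exists p'.
have [Sq Pq Plq] := Aq; exists q; split=> //.
- split=> [|f Bf]; first exact/genring_Bv/poly_genring_lead/Sq.
  by case/Pprime => //; exact/genring_Bv/poly_genring_lead/Sq.
- have Sq' := poly_genring_deriv Sq.
  have Bq' : Bv q^`().[v w].
    by apply: genring_horner (Bv_v w) => i; exact/genring_Bv/Sq'.
  split=> // f Bf /Pprime[] // Pq'; exfalso.
  have := algebraic_size Aq; case Dq: (size q) => [|[|n']] // _.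
  have Pc : ~ P q^`()`_n'.
    rewrite coef_deriv; have [u Ku uE] := Kinv n'.
    move=> /(ciM cP (genring_coef _ Ku)); rewrite -mulr_natl mulrA uE mul1r.
    by move: Plq; rewrite lead_coefE Dq.
  have sq' : size q^`() = n'.+1.
    apply/eqP; rewrite eqn_leq -ltnS -Dq lt_size_deriv; last first.
      by rewrite -size_poly_eq0 Dq.
    rewrite ltnNge; apply: contra_notN Pc => /leq_sizeP/(_ _ (leqnn _)) ->.
    exact: ci0.
  have /qmin : algebraic w q^`() by split=> //; rewrite lead_coefE sq'.
  by rewrite Dq sq' ltnn.
Qed.

(* The derivative of [q.[v w]] is linear in [v (shift i w)], with the separant
   of [q] as leading coefficient. *)
Lemma reductor_shift Q i w q : closed_ideal Q ->
  (forall h, cancellable Q h -> h != 0) ->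
  reductor Q w q -> exists q', reductor Q (shift i w) q'.
Proof.
move=> cQ Qn0 [Sq Qq _ /[dup] cs /Qn0 sn0 _].
have Sl : below w `<=` below (shift i w).
  by move=> u uw; apply: lt_trans uw (shift_lt i w).
have Sd u : below w u -> below (shift i w) (shift i u) by apply: lt_shift.
have [r rE hE] := der_horner i q (v w).
have vS : genring (below (shift i w)) (v w) by apply/genring_var/shift_lt.
set s := q^`().[v w] in cs sn0 hE *.
have sS : genring (below (shift i w)) s.
  apply: genring_horner vS => j.
  exact/(sub_genring Sl)/poly_genring_deriv.
have rS : genring (below (shift i w)) r.[v w].
  by apply: genring_horner vS => j; rewrite rE;
    apply: genring_der Sl Sd _ (Sq j).
have sz : size (s%:P * 'X + (r.[v w])%:P) = 2.
  by rewrite size_MXaddC polyC_eq0 (negPf sn0) size_polyC sn0.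
exists (s%:P * 'X + (r.[v w])%:P); split.
- apply: poly_genringD; last exact: poly_genringC.
  by apply: poly_genringM; [exact: poly_genringC|exact: poly_genringX].
- rewrite hornerMXaddC hornerC -derv -hE; exact: (ci_der cQ).
- by rewrite lead_coefE sz coefD coefMX !coefC /= addr0.
- by rewrite derivMXaddC derivC mul0r addr0 hornerC.
(* An algebraic polynomial is never constant, so degree one is minimal. *)
- by move=> p /algebraic_size; rewrite sz.
Qed.

Lemma cancellable_neq0 h : cancellable P h -> h != 0.
Proof.
case=> _ hP; apply: contra_notN P1 => /eqP h0; apply: hP; first exact: genring1.
by rewrite h0 mulr0; apply: ci0.
Qed.

Lemma reductor_algebraic w q : reductor P w q -> algebraic w q.
Proof.
case=> Sq Pq [_ cl] _ _; split=> // Pl; apply: P1.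
by apply: cl; [exact: genring1|rewrite mul1r].
Qed.

(* Reduction is by induction on the leader and then on the degree in it: a
   leading coefficient in [P] is removed by the former, any other one is
   cancelled against a reductor. *)
Lemma prime_below_reductors (Q : set B) : closed_ideal Q -> Q `<=` P ->
  (forall w p, algebraic w p -> exists q, reductor Q w q) -> P `<=` Q.
Proof.
move=> cQ QP redQ.
(* A constant of [P] outside [K0] would put 1 in [P] by saturation. *)
have PK f : P f -> K f -> Q f.
  move=> Pf Kf; apply: (ci_null cQ); apply: contrapT => K0f.
  by apply: P1; apply: (ci_sat cP (c := f)) => //;
    [exact: genring1|rewrite mulr1].
have main w f : genring (below w `|` [set w]) f -> P f -> Q f.
  elim/(well_founded_ind ltwf): w f => w IH.
  have PQ c : genring (below w) c -> P c -> Q c.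
    by move=> /genring_leader[Kc /PK|[u uw uc]]; [apply|exact: IH uc].
  have {}IH n : forall p : {poly B},
    (size p <= n)%N -> poly_genring (below w) p ->
      P p.[v w] -> Q p.[v w].
    elim: n => [|n IHn] p sp Sp Pp.
      move: sp; rewrite leqn0 size_poly_eq0 => /eqP ->.
      by rewrite horner0; apply: ci0.
    have trunc (q : {poly B}) : (size q <= n.+1)%N -> q`_n = 0 ->
      (size q <= n)%N.
      move=> sq q0; apply/leq_sizeP => j;
        rewrite leq_eqVlt => /orP[/eqP <-//|nj].
      by move/leq_sizeP: sq; apply.
    have [sp'|sp'] := leqP (size p) n; first exact: IHn.
    have {sp sp'} sp : size p = n.+1 by apply/eqP; rewrite eqn_leq sp.
    have lp : lead_coef p = p`_n by rewrite lead_coefE sp.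
    have [Pl|Pl] := pselect (P (lead_coef p)).
      have Ql := PQ _ (poly_genring_lead Sp) Pl.
      have Bvn : Bv (v w ^+ n) by apply/genringX/Bv_v.
      have pE : p = (p - (lead_coef p)%:P * 'X^n) + (lead_coef p)%:P * 'X^n.
        by rewrite subrK.
      have hE : p.[v w] = (p - (lead_coef p)%:P * 'X^n).[v w] + lead_coef p * v
        w ^+ n.
        by rewrite {1}pE hornerD [in X in _ + X]hornerM hornerC hornerXn.
      rewrite hE; apply: (ciD cQ); last exact: ciMr.
      apply: IHn.
      - apply: trunc; last by rewrite coefB coefCM coefXn eqxx mulr1 lp subrr.
        apply: leq_trans (size_polyD _ _) _;
          rewrite size_polyN geq_max sp leqnn /=.
        apply: leq_trans (size_polyMleq _ _) _; rewrite size_polyXn addnS /=.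
        by rewrite size_polyC; case: (_ == _).
      - apply: poly_genringD => //; apply/poly_genringN/poly_genringM;
          last exact: poly_genringXn.
        exact/poly_genringC/poly_genring_lead.
      - have := Pp; rewrite {1}hE => /(ciB cP)/(_ (ciMr cP Bvn Pl)).
        by rewrite addrK.
    have Ap : algebraic w p by [].
    have [q [Sq Qq [Bl cl] _ /(_ _ Ap) sqp]] := redQ w p Ap.
    have q_gt0 : (0 < size q)%N.
      rewrite size_poly_gt0; apply/eqP => q0; apply: P1; apply: QP; apply: cl.
        exact: genring1.
      by rewrite q0 lead_coef0 mulr0; apply: ci0.
    have sq : (size q <= n.+1)%N by rewrite -sp.
    (* One step of pseudo-division by [q]: the shift by [k] aligns the leading terms. *)
    pose k := (n.+1 - size q)%N.
    pose t := (lead_coef p)%:P * (q * 'X^k).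
    pose p1 := (lead_coef q)%:P * p - t.
    have Bp : Bv p.[v w] by exact: (ci_sub cP).
    have Bt : Bv (lead_coef p * v w ^+ k).
      by apply: genringM; [exact/genring_Bv/poly_genring_lead/Sp|exact/genringX/Bv_v].
    apply: cl => //.
    have hE : p1.[v w] = lead_coef q * p.[v w] - lead_coef p * v w ^+ k * q.[v
      w].
      rewrite /p1 /t !(hornerD, hornerN, hornerCM, hornerM, hornerC,
        hornerXn). ring.
    have -> : p.[v w] * lead_coef q = p1.[v w] + lead_coef p * v w ^+ k * q.[v
      w].
      by rewrite hE; ring.
    apply: (ciD cQ); last exact: (ciM cQ).
    apply: IHn.
    - apply: trunc.
        rewrite /p1 /t; apply: leq_trans (size_polyD _ _) _.
        rewrite size_polyN geq_max -sp; apply/andP; split; rewrite mul_polyC.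
          exact: size_scale_leq.
        apply: leq_trans (size_scale_leq _ _) _.
        apply: leq_trans (size_polyMleq _ _) _.
        by rewrite size_polyXn addnS /= subnKC // sp.
      have [nk nkE] : (n < k)%N = false /\ (n - k)%N = (size q).-1 by rewrite
        /k; lia.
      by rewrite /p1 /t coefB !coefCM coefMXn nk nkE -lp -lead_coefE mulrC
        subrr.
    - apply: poly_genringD; first by apply: poly_genringM => //;
        exact/poly_genringC/poly_genring_lead.
      apply/poly_genringN/poly_genringM;
        first exact/poly_genringC/poly_genring_lead.
      by apply: poly_genringM => //; exact: poly_genringXn.
    - rewrite hE; apply: (ciB cP); apply: (ciM cP) => //; exact: QP.
  move=> f /genring_poly[p Sp ->]; exact: IH (leqnn _) Sp.
move=> f Pf; have /genring_leader[Kf|[w _ wf]] := ci_sub cP Pf; first exact: PK.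
exact: main wf Pf.
Qed.

(* [h] is the product of the initials and separants of a characteristic set. *)
Lemma prime_finite_colon : exists (s : seq B) h,
  [/\ [set` s] `<=` P, Bv h, ~ P h & forall f, P f -> gen [set` s] (f * h)].
Proof.
have Er w : (exists p, algebraic w p) -> exists q, reductor P w q.
  by case=> p; apply: algebraic_reductor.
(* By [reductor_shift] the algebraic leaders are stable under derivation. *)
have [|L LE EL] := dickson (E := [set w | exists p, algebraic w p]).
  move=> i w /Er[q] /(reductor_shift i cP cancellable_neq0)[q'].
  by move/reductor_algebraic; exists q'.
have [pol polP] : {pol & forall w, w \in L -> reductor P w (pol w)}.
  apply: (@choice _ _ (fun w q => w \in L -> reductor P w q)) => w.
  have [wL|_] := boolP (w \in L); last by exists 0.
  by have [q] := Er _ (LE _ wL); exists q.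
pose g w := lead_coef (pol w) * (pol w)^`().[v w].
pose h := \prod_(w <- L) g w.
pose s := [seq (pol w).[v w] | w <- L].
have canc_prime a : Bv a -> ~ P a -> cancellable P a.
  by move=> Ba Pa; split=> // f Bf /Pprime[].
have Pcanc a : cancellable P a -> ~ P a.
  by case=> Ba aP Pa; apply: P1; apply: aP; [exact: genring1|rewrite mul1r].
have sP : [set` s] `<=` P.
  by move=> f /= /mapP[w wL ->]; case: (polP w wL).
have cG : closed_ideal (gen [set` s]).
  by apply: gen_closed => f /sP; apply: (ci_sub cP).
have gB w : w \in L -> Bv (g w).
  by move=> wL; have [_ _ [Bl _] [Bs _] _] := polP _ wL; exact: genringM.
have gP w : w \in L -> ~ P (g w).
  move=> wL; have [_ _ cl cs _] := polP _ wL.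
  by case/Pprime; [case: cl|case: cs|exact: Pcanc|exact: Pcanc].
have hL L' : {subset L' <= L} ->
    Bv (\prod_(w <- L') g w) /\ ~ P (\prod_(w <- L') g w).
  elim: L' => [|w L' IH] L'L; first by rewrite big_nil; split;
    first exact: genring1.
  have wL : w \in L by apply: L'L; rewrite inE eqxx.
  have [|Bp Pp] := IH; first by move=> u uL'; apply: L'L; rewrite inE uL' orbT.
  rewrite big_cons; split; first by apply: genringM => //; exact: gB.
  by case/Pprime => //; [exact: gB|exact: gP].
have [Bh Ph] := hL L (fun _ => id).
exists s, h; split=> //.
(* To get [P] inside [Q], it suffices that [Q] has a reductor at every algebraic leader. *)
pose Q : set B := [set f | Bv f /\ gen [set` s] (f * h)].
have cQ : closed_ideal Q by exact: ci_colon.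
have QP : Q `<=` P.
  by move=> f [Bf] /(gen_min cP sP)/Pprime[].
(* For a factor a of [h], the square of f h is a multiple of f a h. *)
have Qcanc a b : Bv a -> Bv b -> h = a * b -> cancellable Q a.
  move=> Ba Bb hE; split=> // f Bf [Bfa Gf]; split=> //.
  apply: ci_sqr => //; first exact: genringM.
  rewrite (_ : _ * _ = b * f * (f * a * h)); last by rewrite hE; ring.
  by apply: genM => //; exact: genringM.
have redQ w : reach L w -> exists q, reductor Q w q.
  elim=> {w} [w wL|i w _ [q]]; last first.
    apply: reductor_shift => // a [_ aQ]; apply/eqP => a0; apply: P1; apply: QP.
    by apply: aQ; [exact: genring1|rewrite a0 mulr0; exact: ci0].
  have [Sq Pq [Bl _] [Bs _] qmin] := polP _ wL.
  have [b Bb hE] : exists2 b, Bv b & h = g w * b.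
    exists (\prod_(u <- rem w L) g u);
      last by rewrite /h (perm_big _ (perm_to_rem wL)) big_cons.
    by have [] := hL (rem w L) (@mem_rem _ _ _).
  exists (pol w); split=> //.
  - split; first exact: (ci_sub cP).
    rewrite mulrC; apply: genM => //; apply: gen_base => /=.
    by apply/mapP; exists w.
  - by apply: (Qcanc _ ((pol w)^`().[v w] * b));
      [|exact: genringM|rewrite hE mulrA].
  - apply: (Qcanc _ (lead_coef (pol w) * b)); [|exact: genringM|] => //.
    by rewrite hE /g; ring.
have PQ : P `<=` Q.
  by apply: prime_below_reductors => // w p Ap; apply: redQ; apply: EL;
    exists p.
by move=> f /PQ[].
Qed.

End PrimeIdeal.

(** * Finite bases and the ascending chain condition *)

Definition finitely_based (P : set B) :=
  exists2 s : seq B, [set` s] `<=` P & P `<=` gen [set` s].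

Lemma seq_setU (s t : seq B) : [set` s ++ t] = [set` s] `|` [set` t].
Proof.
by apply/seteqP; split=> f /=; rewrite mem_cat => /orP.
Qed.

(** Each element of a finite basis is generated by [a] and finitely many elements of [P]; collect
    the latter. *)
Lemma finitely_based_extend (P : set B) a : closed_ideal P -> Bv a ->
  finitely_based (gen (P `|` [set a])) ->
  exists2 s : seq B, [set` s] `<=` P & P `<=` gen ([set` s] `|` [set a]).
Proof.
move=> cP Ba [s sP Ps].
have [t tP ts] : exists2 t : seq B, [set` t] `<=` P &
    [set` s] `<=` gen ([set` t] `|` [set a]).
  elim: s sP {Ps} => [|f s IH] sP; first by exists [::].
  have [|t tP ts] := IH; first by move=> g gs; apply: sP;
    rewrite /= inE gs orbT.
  have [u uP uf] := gen_finite (sP f (mem_head _ _)).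
  exists ([seq g <- u | g != a] ++ t).
    rewrite seq_setU => g [/=|/tP//];
      rewrite mem_filter => /andP[/eqP ga /uP[//|]].
    by move=> /ga.
  move=> g /=; rewrite inE => /predU1P[->|/ts].
    apply: sub_gen uf => b ub; rewrite seq_setU.
    have [->|ba] := eqVneq b a; first by right.
    by left; left; rewrite /= mem_filter ba.
  by apply: sub_gen => b [tb|->]; [left; rewrite seq_setU; right|right].
exists t => // f Pf; have Gf : gen (P `|` [set a]) f by apply: gen_base; left.
apply: (gen_min _ ts (Ps _ Gf)).
by apply: gen_closed => b [/tP/(ci_sub cP)//|->].
Qed.

(** Zorn's lemma gives a maximal counterexample; it is prime, and [prime_finite_colon] leads to a
    finite basis for it. *)
Theorem closed_ideal_finitely_based (P : set B) :
  closed_ideal P -> finitely_based P.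
Proof.
move=> cP; apply: contrapT => nP.
pose bad (P : set B) := closed_ideal P /\ ~ finitely_based P.
have [|M [[M0|[cM nM]] Mmax]] :=
    @Zorn_bigcup B (fun P => P = set0 \/ bad P).
- move=> F Fbad Ftot; have [[A [FA A0]]|Fn] := pselect (exists A,
    F A /\ A <> set0); last first.
    left; apply/seteqP; split=> // f [A FA Af]; apply: Fn; exists A;
      split=> // A0.
    by rewrite A0 in Af.
  right; have FA' A' f : F A' -> A' f -> bad A'.
    by move=> /Fbad[->|].
  have [A1 A2] : bad A by case: (Fbad _ FA).
  have up : forall f g, (\bigcup_(C in F) C) f -> (\bigcup_(C in F) C) g ->
      exists C, [/\ F C, C f & C g].
    move=> f g [C FC Cf] [C' FC' C'g]; have [CC|CC] := Ftot _ _ FC FC'.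
      by exists C'; split=> //; apply: CC.
    by exists C; split=> //; apply: CC.
  have lift f C : F C -> C f -> closed_ideal C by move=> FC /(FA' _ _ FC)[].
  split.
    split.
    + by move=> f [C FC Cf]; exact: (ci_sub (lift _ _ FC Cf)).
    + by move=> f K0f; exists A => //; apply: (ci_null A1).
    + move=> f g Uf Ug; have [C [FC Cf Cg]] := up _ _ Uf Ug; exists C => //.
      by apply: (ciD (lift _ _ FC Cf)).
    + by move=> b f Bb [C FC Cf]; exists C => //; apply: (ciM (lift _ _ FC Cf)).
    + by move=> f n Bf [C FC Cf]; exists C => //;
        apply: (ci_rad (lift _ _ FC Cf)) Cf.
    + by move=> i f [C FC Cf]; exists C => //; apply: (ci_der (lift _ _ FC Cf)).
    + move=> c f Bf Kc K0c [C FC Cf]; exists C => //.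
      by apply: (ci_sat (lift _ _ FC Cf)) Cf.
  case=> s sF Fs.
  (* A finite basis of the union lies in one member of the chain, taken nonempty so that it is
     bad. *)
  have [C FC [C1 sC]] : exists2 C, F C & C !=set0 /\ [set` s] `<=` C.
    elim: s sF {Fs} => [|f s IH] sF.
      by exists A => //; split=> //; apply/set0P/eqP.
    have [|C FC [[g Cg] sC]] := IH; first by move=> g gs; apply: sF;
      rewrite /= inE gs orbT.
    have [|C' FC' C'f] := sF f; first by rewrite /= mem_head.
    have [CC|CC] := Ftot _ _ FC FC'.
      exists C' => //; split; first by exists f.
      by move=> b /=; rewrite inE => /predU1P[->//|/sC/CC].
    exists C => //; split; first by exists g.
    by move=> b /=; rewrite inE => /predU1P[->|/sC//]; apply: CC.
  case: C1 => g Cg; have [cC nC] := FA' _ _ FC Cg.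
  by apply: nC; exists s => // f Cf; apply: Fs; exists C.
- apply: (Mmax P); last by right.
  rewrite M0; split=> [|P0 //]; first exact: sub0set.
  by have /P0 := ci0 cP.
have big a : Bv a -> ~ M a ->
    exists2 s : seq B, [set` s] `<=` M & M `<=` gen ([set` s] `|` [set a]).
  move=> Ba Ma; apply: finitely_based_extend => //; apply: contrapT => nG.
  have cG : closed_ideal (gen (M `|` [set a])).
    by apply: gen_closed => b [/(ci_sub cM)//|->//].
  apply: (Mmax (gen (M `|` [set a]))); last by right.
  split=> [f Mf|/(_ a)]; first by apply: gen_base; left.
  by move=> Ga; apply: Ma; apply: Ga; apply: gen_base; right.
have MB (s : seq B) : [set` s] `<=` M -> [set` s] `<=` Bv.
  by move=> sM f /sM; apply: (ci_sub cM).
have M1 : ~ M 1.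
  move=> M1; apply: nM; exists [:: 1] => [f|f /(ci_sub cM) Bf].
    by rewrite /= inE => /eqP ->.
  by rewrite -[f]mulr1; apply: genM => //; apply: gen_base; rewrite /= inE.
(* Were f and g outside [M], any b in [M] would be generated by [s] with f and by [t] with g, hence
   its square by [s], [t] and f g. *)
have Mprime f g : Bv f -> Bv g -> M (f * g) -> M f \/ M g.
  move=> Bf Bg Mfg; apply: contrapT =>
    /not_orP[/(big _ Bf)[s sM Ms] /(big _ Bg)[t tM Mt]].
  apply: nM; exists (f * g :: s ++ t).
    by move=> b /=; rewrite inE mem_cat => /predU1P[->//|/orP[/sM|/tM]].
  move=> b Mb.
  have cG : closed_ideal (gen [set` f * g :: s ++ t]).
    apply: gen_closed => c /=;
      rewrite inE mem_cat => /predU1P[->|/orP[/MB|/MB]].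
    - exact: genringM.
    - exact.
    - exact.
  apply: (ci_sqr cG); first exact: (ci_sub cM).
  apply: (gen_mul cG _ _ _ (Ms _ Mb) (Mt _ Mb)).
  - by move=> c [/MB|->]; [apply|].
  - by move=> c [/MB|->]; [apply|].
  have G c : c \in f * g :: s ++ t -> gen [set` f * g :: s ++ t] c by move=> ?;
    exact: gen_base.
  move=> a c [sa|->] [tc|->].
  - by apply: genM; [exact: MB sa|apply: G; rewrite inE mem_cat tc !orbT].
  - by rewrite [a * _]mulrC; apply: genM => //; apply: G;
      rewrite inE mem_cat sa !orbT.
  - by apply: genM => //; apply: G; rewrite inE mem_cat tc !orbT.
  - by apply: G; rewrite mem_head.
have [s [h [sM Bh Mh sh]]] := prime_finite_colon cM M1 Mprime.
(* [M] is generated by [t] with [h], and its multiples by [h] are generated by [s]; so [s] and [t]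
   generate the squares of its elements. *)
have [t tM Mt] := big _ Bh Mh.
apply: nM; exists (s ++ t); first by rewrite seq_setU => f [/sM|/tM].
move=> f Mf.
have cG : closed_ideal (gen [set` s ++ t]).
  by apply: gen_closed; rewrite seq_setU => b [/MB|/MB]; apply.
have Bf := ci_sub cM Mf.
apply: (ci_sqr cG) => //.
suff: (fun g => Bv g /\ gen [set` s ++ t] (g * f)) f by case.
apply: (gen_min (ci_colon cG Bf)) (Mt _ Mf) => g [tg|->].
  split; first exact: MB tg.
  rewrite mulrC; apply: genM => //; apply: gen_base; rewrite seq_setU; by right.
split=> //; rewrite mulrC; apply: sub_gen (sh _ Mf).
by rewrite seq_setU => b; left.
Qed.

Theorem closed_ideal_acc (P : nat -> set B) :
  (forall n, closed_ideal (P n)) -> (forall n, P n `<=` P n.+1) ->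
  exists N, forall n, (N <= n)%N -> P n = P N.
Proof.
move=> cP incP.
have le n n' : (n <= n')%N -> P n `<=` P n'.
  move=> /subnK <-; elim: (n' - n)%N => [//|k IH] f /IH; exact: incP.
have cU : closed_ideal (\bigcup_n P n).
  split.
  - by move=> f [n _]; apply: (ci_sub (cP n)).
  - by move=> f K0f; exists 0%N => //; apply: (ci_null (cP 0%N)).
  - move=> f g [n _ Pf] [n' _ Pg]; exists (maxn n n') => //.
    by apply: (ciD (cP _)); [apply: le Pf; exact: leq_maxl|apply: le Pg;
      exact: leq_maxr].
  - by move=> b f Bb [n _ Pf]; exists n => //; apply: (ciM (cP n)).
  - by move=> f k Bf [n _ Pf]; exists n => //; apply: (ci_rad (cP n)) Pf.
  - by move=> i f [n _ Pf]; exists n => //; apply: (ci_der (cP n)).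
  - by move=> c f Bf Kc K0c [n _ Pf]; exists n => //; apply: (ci_sat (cP n)) Pf.
have [s sU Us] := closed_ideal_finitely_based cU.
have [N sN] : exists N, [set` s] `<=` P N.
  elim: s sU {Us} => [|f s IH] sU; first by exists 0%N.
  have [|N sN] := IH; first by move=> g gs; apply: sU; rewrite /= inE gs orbT.
  have [|n _ Pf] := sU f; first by rewrite /= mem_head.
  exists (maxn n N) => b /=; rewrite inE => /predU1P[->|/sN].
    by apply: le Pf; exact: leq_maxl.
  by apply: le; exact: leq_maxr.
exists N => n Nn; apply/seteqP; split; last exact: le.
move=> f Pf; apply: (gen_min (cP N) sN); apply: Us; by exists n.
Qed.

End RittRaudenbush.

(** * Dickson's lemma and the ranking of derivatives *)

Section Dickson.
Variable N : nat.
Implicit Types (m l : multinom N) (E : set (multinom N)).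

(** Comparing only [n] coordinates permits induction on [n] inside a fixed [multinom N]. *)
Definition lem_upto n l m := forall i : 'I_N, (i < n)%N -> (l i <= m i)%N.

Definition update m (j : 'I_N) t : multinom N :=
  Multinom [tuple if i == j then t else m i | i < N].

Lemma updateE m j t i : update m j t i = if i == j then t else m i.
Proof. exact: mnmE. Qed.

(** The projection forgetting coordinate [j] has a finite basis, which lifts to [E] at a common
    height [M]. It covers heights from [M] on; the heights below [M] are finitely many slices. *)
Lemma dickson_upto n E : (n <= N)%N ->
  (forall l m, E l -> lem_upto n l m -> E m) ->
  exists2 L : seq (multinom N), {in L, forall l, E l} &
    forall m, E m -> exists2 l, l \in L & lem_upto n l m.
Proof.
elim: n E => [|n IH] E nN Eup.
  have [[m Em]|E0] := pselect (exists m, E m).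
    by exists [:: m] => [l|l _]; [rewrite inE => /eqP ->|exists m;
      rewrite ?inE].
  by exists [::] => // m Em; case: E0; exists m.
pose j := Ordinal nN.
have updup l m t t' : lem_upto n l m -> (t <= t')%N ->
    lem_upto n.+1 (update l j t) (update m j t').
  move=> lm tt' i; rewrite ltnS leq_eqVlt !updateE => /predU1P[ij|i_lt].
    by rewrite (_ : i == j) //; apply/eqP/val_inj.
  by case: (i == j) => //; apply: lm.
have updid m : lem_upto n.+1 (update m j (m j)) m.
  by move=> i _; rewrite updateE; case: eqP => [->|].
have slice t : exists2 L : seq (multinom N), {in L, forall l,
  E (update l j t)} &
    forall m, E (update m j t) -> exists2 l, l \in L & lem_upto n l m.
  apply: IH => [|l m El lm]; first exact: ltnW.
  exact: Eup El (updup _ _ _ _ lm (leqnn t)).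
have [L LE EL] : exists2 L : seq (multinom N),
    {in L, forall l, exists t, E (update l j t)} &
    forall m, (exists t, E (update m j t)) -> exists2 l,
      l \in L & lem_upto n l m.
  apply: (IH [set m | exists t, E (update m j t)]) => [|l m [t El] lm];
    first exact: ltnW.
  by exists t; apply: Eup El (updup _ _ _ _ lm (leqnn t)).
have [M LM] : exists M, {in L, forall l, E (update l j M)}.
  elim: L LE {EL} => [|l L IHL] LE; first by exists 0%N.
  have [|M LM] := IHL; first by move=> l' l'L; apply: LE; rewrite inE l'L orbT.
  have [t Et] := LE l (mem_head _ _).
  have up l' : lem_upto n l' l' by [].
  exists (maxn t M) => l'; rewrite inE => /predU1P[->|/LM El'].
    exact: Eup Et (updup _ _ _ _ (up _) (leq_maxl _ _)).
  exact: Eup El' (updup _ _ _ _ (up _) (leq_maxr _ _)).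
have [F FP] := choice (fun t => let: ex_intro2 L A B := slice t in
  ex_intro (fun L : seq (multinom N) => {in L, forall l, E (update l j t)} /\
    forall m, E (update m j t) -> exists2 l,
      l \in L & lem_upto n l m) L (conj A B)).
exists ([seq update l j M | l <- L] ++
  flatten [seq [seq update l j t | l <- F t] | t <- iota 0 M]).
  move=> l; rewrite mem_cat => /orP[/mapP[l' /LM El' ->]//|/flattenP[s]].
  by move=> /mapP[t _ ->] /mapP[l' l'F ->]; case: (FP t) => [+ _]; apply.
move=> m Em.
have Emj : E (update m j (m j)).
  apply: Eup Em _ => i _; rewrite updateE.
  by case: eqP => [->|].
have trans l t : lem_upto n l m -> (t <= m j)%N ->
  lem_upto n.+1 (update l j t) m.
  by move=> lm tm i i_lt; apply: leq_trans (updid m i i_lt); apply: updup.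
have [Mm|mM] := leqP M (m j).
  have [|l lL lm] := EL m; first by exists (m j).
  exists (update l j M); last exact: trans.
  by rewrite mem_cat; apply/orP; left; apply: map_f.
have [_ /(_ m Emj)[l lF lm]] := FP (m j).
exists (update l j (m j)); last exact: trans.
rewrite mem_cat; apply/orP; right; apply/flattenP.
exists [seq update l j (m j) | l <- F (m j)]; last exact: map_f.
by apply: (map_f (fun t => [seq update l j t | l <- F t])); rewrite mem_iota.
Qed.

(** Climb from l to m by unit steps, by induction on the total gap. *)
Lemma multinom_step (Q : set (multinom N)) :
  (forall i m, Q m -> Q (mnm_add m (mnm1 i))) ->
  forall l m, Q l -> (forall i, (l i <= m i)%N) -> Q m.
Proof.
move=> Qs l m Ql lm; have [d] := ubnP (\sum_i (m i - l i)).
elim: d m lm => // d IH m lm; rewrite ltnS => md.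
have [[i im]|ml] := pselect (exists i, l i < m i)%N; last first.
  suff -> : m = l by [].
  apply/mnmP => i; apply/eqP; rewrite eqn_leq lm andbT leqNgt.
  by apply/negP => im; apply: ml; exists i.
have mE : m = mnm_add (mnm_sub m (mnm1 i)) (mnm1 i).
  by rewrite submK // lep1mP -lt0n; apply: leq_ltn_trans im.
rewrite mE; apply/Qs/IH => [j|].
  by rewrite mnmBE mnm1E; have := lm j; case: eqP => [<-|_] /=; lia.
apply: leq_trans md; rewrite (bigD1 i) //= [X in (_ < X)%N](bigD1 i) //=.
rewrite mnmBE mnm1E eqxx -addSn leq_add //; first by lia.
by apply: leq_sum => j ij; rewrite mnmBE; lia.
Qed.

Variable k : nat.

(** A pair (j, e) stands for the derivative of multi-order e of the j-th unknown. *)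
Definition jet_shift (i : 'I_N) (w : 'I_k * multinom N) :=
  (w.1, mnm_add w.2 (mnm1 i)).

(** An orderly ranking: the order on monomials compares total degrees first. *)
Definition jet_lt (u w : 'I_k * multinom N) : Prop :=
  (u.2 < w.2)%O \/ u.2 = w.2 /\ (u.1 < w.1)%N.

(** Dickson's lemma for each unknown. Quantifying over shift-stable [Q] says that w is an iterated
    derivative of l. *)
Lemma jet_dickson (E : set ('I_k * multinom N)) :
  (forall i w, E w -> E (jet_shift i w)) ->
  exists2 L : seq ('I_k * multinom N), {in L, forall w, E w} &
    forall w, E w -> exists2 l, l \in L &
      forall Q : set ('I_k * multinom N),
        (forall i u, Q u -> Q (jet_shift i u)) -> Q l -> Q w.
Proof.
move=> Es.
have Eup j : forall l m, E (j, l) -> (forall i, (l i <= m i)%N) -> E (j, m).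
  move=> l m; apply: (@multinom_step [set m | E (j, m)]) => i {}m.
  exact: Es i (j, m).
have sl j : exists L : seq (multinom N), {in L, forall l, E (j, l)} /\
    forall m, E (j, m) -> exists2 l, l \in L & lem_upto N l m.
  have [//||L LE EL] := @dickson_upto N [set m | E (j, m)]; last by exists L.
  by move=> l m El lm; apply: Eup El _ => i; apply: lm.
have [F FP] := choice sl.
exists (flatten [seq [seq (j, l) | l <- F j] | j <- enum 'I_k]).
  move=> w /flattenP[s /mapP[j _ ->] /mapP[l lF ->]].
  by case: (FP j) => + _; apply.
move=> [j m] Ew; have [_ /(_ _ Ew)[l lF lm]] := FP j.
exists (j, l).
  apply/flattenP; exists [seq (j, l) | l <- F j]; last exact: map_f.
  by apply: (map_f (fun j => [seq (j, l) | l <- F j])); rewrite mem_enum.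
move=> Q Qs Ql; apply: (@multinom_step [set m | Q (j, m)]) Ql _ => [i m'|i].
  exact: Qs i (j, m').
exact: lm.
Qed.

Lemma jet_lt_trans u w z : jet_lt u w -> jet_lt w z -> jet_lt u z.
Proof.
move=> [uw|[uw uw']] [wz|[wz wz']].
- by left; apply: lt_trans wz.
- by left; rewrite -wz.
- by left; rewrite uw.
- by right; split; [rewrite uw|apply: ltn_trans wz'].
Qed.

Lemma jet_lt_total u w : [\/ jet_lt u w, u = w | jet_lt w u].
Proof.
case: u w => [j m] [j' m']; case: (ltgtP m m') => [lt|gt|->].
- by constructor 1; left.
- by constructor 3; left.
- case: (ltngtP j j') => [lt|gt|/val_inj->].
  + by constructor 1; right.
  + by constructor 3; right.
  + by constructor 2.
Qed.

Lemma jet_lt_wf : well_founded jet_lt.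
Proof.
case=> j m; elim/(well_founded_ind (@ltom_wf N)): m j => m IHm j.
have [d jd] : exists d, nat_of_ord j = d by exists j.
elim/ltn_ind: d j jd => d IHd j jd.
constructor=> -[j' m'] [/= lt_m|[/= -> lt_j]]; first exact: IHm.
by apply: (IHd j') => [|//]; rewrite -jd.
Qed.

Lemma jet_shift_mono i u w : jet_lt u w ->
  jet_lt (jet_shift i u) (jet_shift i w).
Proof.
move=> [uw|[uw uw']]; first by left; rewrite /= ltmc_add2l.
by right; rewrite /= uw.
Qed.

Lemma jet_lt_shift i w : jet_lt w (jet_shift i w).
Proof. by left; rewrite /= lt_mdeg_ltmc // mdegD mdeg1 addn1. Qed.

End Dickson.

(** * Generation of free algebras and coproducts *)

Record poisson_closed (R : comNzRingType) (A : poissonAlgType R) (S : set A) :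
    Prop := PoissonClosed {
  pc1 : S 1;
  pcD : forall a b, S a -> S b -> S (a + b);
  pcZ : forall (r : R) a, S a -> S (r *: a);
  pcM : forall a b, S a -> S b -> S (a * b);
  pc_brk : forall a b, S a -> S b -> S (brk a b)
}.

Section Subalgebra.
Variables (R : comNzRingType) (A : poissonAlgType R) (S : set A).
Hypothesis cS : poisson_closed S.

Definition subalgebra (_ : poisson_closed S) : Type := {a : A | `[< S a >]}.

HB.instance Definition _ := SubChoice.on (subalgebra cS).

Lemma subalgebra_subring : subring_closed [pred a : A | `[< S a >]].
Proof.
have SN a : S a -> S (- a) by rewrite -scaleN1r; apply: (pcZ cS).
split=> [|a b|a b]; rewrite !inE; first exact: (pc1 cS).
  by move=> Sa Sb; apply: (pcD cS) => //; apply: SN.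
exact: (pcM cS).
Qed.

HB.instance Definition _ :=
  GRing.SubChoice_isSubComNzRing.Build A _ (subalgebra cS) subalgebra_subring.

Lemma subalgebra_submod : subsemimod_closed [pred a : A | `[< S a >]].
Proof.
split=> [|r a]; last by rewrite !inE; apply: (pcZ cS).
split=> [|a b]; rewrite !inE; last exact: (pcD cS).
by rewrite -(scale0r 1); apply/(pcZ cS)/(pc1 cS).
Qed.

HB.instance Definition _ :=
  GRing.SubZmodule_isSubLmodule.Build R A _ (subalgebra cS) subalgebra_submod.
HB.instance Definition _ :=
  GRing.SubNzSemiRing_SubLSemiModule_isSubLSemiAlgebra.Build R A _ (subalgebra
    cS).
HB.instance Definition _ :=
  GRing.SubLSemiAlgebra_isSubSemiAlgebra.Build R A _ (subalgebra cS).

Lemma subalgebraP (a : (subalgebra cS)) : S (val a).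
Proof. exact/asboolP/(valP a). Qed.

Definition subalgebra_brk (a b : (subalgebra cS)) : (subalgebra cS) :=
  exist _ (brk (val a) (val b))
    (introT (asboolP _) (pc_brk cS (subalgebraP a) (subalgebraP b))).

Lemma subalgebra_brkDZl (r : R) a b c :
  subalgebra_brk (r *: a + b) c = r *: subalgebra_brk a c + subalgebra_brk b c.
Proof. by apply: val_inj; rewrite /= brkDZl. Qed.

Lemma subalgebra_brkxx a : subalgebra_brk a a = 0.
Proof. by apply: val_inj; rewrite /= brkxx. Qed.

Lemma subalgebra_brk_jacobi a b c :
  subalgebra_brk a (subalgebra_brk b c) + subalgebra_brk b (subalgebra_brk c a)
  + subalgebra_brk c (subalgebra_brk a b) = 0.
Proof. by apply: val_inj; rewrite /= brk_jacobi. Qed.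

Lemma subalgebra_brk_leibniz a b c :
  subalgebra_brk a (b * c) = subalgebra_brk a b * c + b * subalgebra_brk a c.
Proof. by apply: val_inj; rewrite /= brk_leibniz. Qed.

HB.instance Definition _ := hasPoissonBracket.Build R (subalgebra cS)
  subalgebra_brkDZl subalgebra_brkxx subalgebra_brk_jacobi
  subalgebra_brk_leibniz.

Definition subalgebra_val (a : (subalgebra cS)) : A := val a.

Fact subalgebra_val_linear : linear subalgebra_val.
Proof. by []. Qed.

Fact subalgebra_val_monoid : monoid_morphism subalgebra_val.
Proof. by []. Qed.

HB.instance Definition _ :=
  GRing.isLinear.Build R (subalgebra cS) A _ subalgebra_val
    subalgebra_val_linear.
HB.instance Definition _ :=
  GRing.isMonoidMorphism.Build (subalgebra cS) A subalgebra_val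
    subalgebra_val_monoid.
HB.instance Definition _ :=
  isPoissonMorphism.Build R (subalgebra cS) A subalgebra_val (fun _ _ => erefl).

Variables (C : poissonAlgType R) (f : {poisson C -> A}).
Hypothesis Sf : forall c, S (f c).

Definition corestrict (c : C) : (subalgebra cS) :=
  exist _ (f c) (introT (asboolP _) (Sf c)).

Fact corestrict_linear : linear corestrict.
Proof. by move=> r a b; apply: val_inj; rewrite /= linearP. Qed.

Fact corestrict_monoid : monoid_morphism corestrict.
Proof.
by split=> [|a b]; apply: val_inj; rewrite /= ?rmorph1 ?rmorphM.
Qed.

Fact corestrict_brk : {morph corestrict : a b / brk a b >-> brk a b}.
Proof. by move=> a b; apply: val_inj; rewrite /= brk_morph. Qed.

HB.instance Definition _ :=
  GRing.isLinear.Build R C (subalgebra cS) _ corestrict corestrict_linear.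
HB.instance Definition _ :=
  GRing.isMonoidMorphism.Build C (subalgebra cS) corestrict corestrict_monoid.
HB.instance Definition _ :=
  isPoissonMorphism.Build R C (subalgebra cS) corestrict corestrict_brk.

End Subalgebra.

Section Terms.
Variable R : comNzRingType.
Implicit Types A B D : poissonAlgType R.

Lemma peval_morph A B (f : {poisson A -> B}) V (w : V -> A) t :
  f (peval w t) = peval (f \o w) t.
Proof.
elim: t => //= [|t1 <- t2 <-|r t <-|t1 <- t2 <-|t1 <- t2 <-].
- exact: rmorph1.
- exact: rmorphD.
- exact: linearZ.
- exact: rmorphM.
- exact: brk_morph.
Qed.

Lemma peval_ext A V (w w' : V -> A) t : w =1 w' -> peval w t = peval w' t.
Proof. by move=> ww'; congr peval; apply/funext. Qed.

Lemma variety_subalgebra M A (S : set A) (cS : poisson_closed S) :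
  is_variety M -> M A -> M (subalgebra cS).
Proof.
move=> [T TM] /TM TA; apply/TM => t /TA tA w; apply: val_inj.
rewrite -[LHS]/(subalgebra_val _) peval_morph tA.
by rewrite -[RHS]/(subalgebra_val _) raddf0.
Qed.

Lemma subalgebra_total A (S : set A) (cS : poisson_closed S)
  (f : {poisson A -> subalgebra cS}) :
  (forall a, val (f a) = a) -> forall a, S a.
Proof. by move=> fE a; rewrite -[a]fE; apply: subalgebraP. Qed.

(** Subalgebras stay in the variety, so the universal map into [S], followed by inclusion, fixes the
    generators and is the identity. *)
Lemma free_ind M X A (x : X -> A) (S : set A) : is_variety M -> is_free M x ->
  poisson_closed S -> (forall i, S (x i)) -> forall a, S a.
Proof.
move=> varM [MA freeA] cS Sx.
pose y i : subalgebra cS := exist _ (x i) (introT (asboolP _) (Sx i)).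
have [f [fx _]] := freeA _ (variety_subalgebra cS varM MA) y.
apply: (@subalgebra_total _ _ cS f) => a.
have [g [gx guniq]] := freeA _ MA x.
rewrite -[RHS]/(idfun a) (guniq idfun) //.
by rewrite -[LHS]/((subalgebra_val (cS := cS) \o f) a); apply: guniq => i /=;
  rewrite fx.
Qed.

Lemma coproduct_ind M A B D (iA : {poisson A -> D}) (iB : {poisson B -> D})
    (S : set D) : is_variety M -> is_coproduct M iA iB -> poisson_closed S ->
  (forall a, S (iA a)) -> (forall b, S (iB b)) -> forall d, S d.
Proof.
move=> varM [MD copD] cS SA SB.
have [f [fA fB _]] := copD _ (variety_subalgebra cS varM MD)
  (corestrict cS SA) (corestrict cS SB).
apply: (@subalgebra_total _ _ cS f) => d.
have [g [_ _ guniq]] := copD _ MD iA iB.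
rewrite -[RHS]/(idfun d) (guniq idfun) //.
rewrite -[LHS]/((subalgebra_val (cS := cS) \o f) d).
by apply: guniq => c /=; rewrite ?fA ?fB.
Qed.

Lemma free_term M X A (x : X -> A) : is_variety M -> is_free M x ->
  forall a, exists t, a = peval x t.
Proof.
move=> varM freeA; apply: (free_ind varM freeA) => [|i];
  last by exists (PVar R i).
split.
- by exists POne.
- by move=> _ _ [t1 ->] [t2 ->]; exists (PAdd t1 t2).
- by move=> r _ [t ->]; exists (PScale r t).
- by move=> _ _ [t1 ->] [t2 ->]; exists (PMul t1 t2).
- by move=> _ _ [t1 ->] [t2 ->]; exists (PBrk t1 t2).
Qed.

End Terms.

(** * Differential loci *)

HB.instance Definition _ (R : idomainType) (m : nat) :=
  GRing.IntegralDomain.copy (symplectic R m) (mpoly m.*2 R).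

Lemma natr_inverse (R : comNzRingType) (m : nat) (QinR : {rmorphism rat ->
  R}) n :
  exists u : symplectic R m, u * n.+1%:R = 1.
Proof.
exists (QinR n.+1%:R^-1)%:A; rewrite mulr_natr -scaler_nat scalerA mulrC.
rewrite -(rmorph_nat QinR) -rmorphM mulVf ?rmorph1 ?scale1r //.
by rewrite pnatr_eq0.
Qed.

Section DifferentialLoci.
Variables (R : idomainType) (QinR : {rmorphism rat -> R}) (m k : nat).
Local Notation P := (symplectic R m).
Variables (Omega J : Type) (G : set_system J) (coord : Omega -> 'I_k -> J -> P).
Hypothesis GU : UltraFilter G.

(* The arguments [o] and [j] only serve to make the type pointed, so that the
   functions on it form a nonzero ring. *)
Definition points (o : Omega) (j : J) : Type := {classic (Omega * J)}.

HB.instance Definition _ o j := Choice.on (points o j).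
HB.instance Definition _ o j := isPointed.Build (points o j) (o, j).

Variables (o0 : Omega) (j0 : J).
Local Notation T := (points o0 j0).
Local Notation B := (T -> P).

Definition fder (i : 'I_m.*2) (f : B) : B := fun t => partial i (f t).
(** Modulo [fnull], these coefficients form the ultrapower of P along [G], a differential domain. *)
Definition fconst : set B := [set f | exists c : J -> P, forall t : T,
  f t = c t.2].
Definition fnull : set B := [set f | exists2 c : J -> P,
  forall t : T, f t = c t.2 & G [set j | c j = 0]].
(** The differential indeterminates, as functions of the point and of the index through which it is
    read in P. *)
Definition jet_coord (w : 'I_k * multinom m.*2) : B :=
  fun t => mderivm w.2 (coord t.1 w.1 t.2).

Definition diff_poly := genring fconst jet_coord setT.

Lemma fderD i : {morph fder i : f g / f + g}.
Proof. by move=> f g; apply/funext => t; rewrite /fder /= raddfD. Qed.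

Lemma fderM i f g : fder i (f * g) = fder i f * g + f * fder i g.
Proof. by apply/funext => t; rewrite /fder /= partialM. Qed.

Lemma fder_jet i w : fder i (jet_coord w) = jet_coord (jet_shift i w).
Proof.
by apply/funext => t; rewrite /fder /jet_coord /= mderivmDm mderivmU1m.
Qed.

Lemma fconstD f g : fconst f -> fconst g -> fconst (f + g).
Proof.
by move=> [c fE] [d gE]; exists (fun j => c j + d j) => t; rewrite -fE -gE.
Qed.

Lemma fconstM f g : fconst f -> fconst g -> fconst (f * g).
Proof.
by move=> [c fE] [d gE]; exists (fun j => c j * d j) => t; rewrite -fE -gE.
Qed.

Lemma fconst_der i f : fconst f -> fconst (fder i f).
Proof. by move=> [c fE]; exists (fun j => partial i (c j)) => t;
  rewrite -fE. Qed.

Lemma fconst_cst (p : P) : fconst (fun=> p).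
Proof. by exists (fun=> p). Qed.

Lemma fconst_inv n : exists2 u, fconst u & u * n.+1%:R = 1.
Proof.
have [u uE] := natr_inverse m QinR n.
exists (fun=> u); first exact: fconst_cst.
have natE k' (t : T) : (k'%:R : B) t = k'%:R.
  by elim: k' => [//|k' IH]; rewrite -addn1 !natrD -IH.
by apply/funext => t; rewrite -[LHS]/(u * (n.+1%:R : B) t) natE uE.
Qed.

Lemma diff_poly_der i f : diff_poly f -> diff_poly (fder i f).
Proof.
apply: (genring_der fderD fderM fder_jet fconst_der) => //.
Qed.

Definition vanish (C : set Omega) : set B :=
  [set f | diff_poly f /\ forall o, C o -> G [set j | f (o, j) = 0]].

(** Radicality holds because P is a domain, saturation because moreover [G] is an ultrafilter: a
    constant outside [fnull] is nonzero at almost every index. *)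
Lemma vanish_closed C : closed_ideal fder fconst fnull jet_coord (vanish C).
Proof.
split=> /=.
- by move=> f [].
- move=> f [c fE Gc]; split; first by apply: genring_coef; exists c.
  by move=> o _; apply: filterS Gc => j /= cj; rewrite fE.
- move=> f g [df Gf] [dg Gg]; split; first exact: genringD.
  move=> o Co; apply: filterS2 (Gf o Co) (Gg o Co) => j /= fj gj.
  by rewrite -[LHS]/(f (o, j) + g (o, j)) fj gj addr0.
- move=> b f db [df Gf]; split; first exact: genringM.
  move=> o Co; apply: filterS (Gf o Co) => j /= fj.
  by rewrite -[LHS]/(b (o, j) * f (o, j)) fj mulr0.
- move=> f n df [_ Gf]; split=> // o Co; apply: filterS (Gf o Co) => j /=.
  have -> : (f ^+ n) (o, j) = f (o, j) ^+ n.
    elim: n {Gf} => [//|n IH]; rewrite !exprS -IH //.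
  by move/eqP; rewrite expf_eq0 => /andP[_ /eqP].
- move=> i f [df Gf]; split; first exact: diff_poly_der.
  by move=> o Co; apply: filterS (Gf o Co) => j /= fj; rewrite /fder fj raddf0.
- move=> c f df [d cE] c0 [_ Gf]; split=> // o Co.
  have [Gd|Gd] := in_ultra_setVsetC [set j | d j = 0] GU.
    by case: c0; exists d.
  apply: filterS2 Gd (Gf o Co) => j /= dj.
  rewrite -[LHS]/(c (o, j) * f (o, j)) cE => /eqP.
  by rewrite mulf_eq0 => /orP[/eqP|/eqP].
Qed.

Lemma diff_loci_noetherian (C : nat -> set Omega) :
  (forall n, C n.+1 `<=` C n) ->
  exists N, forall n, (N <= n)%N -> vanish (C n) = vanish (C N).
Proof.
move=> decC.
apply: (@closed_ideal_acc B 'I_m.*2 ('I_k * multinom m.*2)%type fder fconst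
  fnull jet_coord (@jet_shift m.*2 k) (@jet_lt m.*2 k)).
- exact: fderD.
- exact: fderM.
- exact: fder_jet.
- exact: fconstD.
- exact: fconstM.
- exact: fconst_der.
- by exists (fun=> - 1).
- exact: fconst_inv.
- by move=> f [c fE _]; exists c.
- by exists (fun=> 0) => //; apply: filterS filterT.
- exact: jet_lt_wf.
- exact: jet_lt_trans.
- exact: jet_lt_total.
- exact: jet_shift_mono.
- exact: jet_lt_shift.
- move=> E /jet_dickson[L LE EL]; exists L => // w /EL[l lL]; apply.
    by move=> i u; apply: reachS.
  exact: reach0.
- by move=> n; apply: vanish_closed.
- by move=> n f [df Gf]; split=> // o /decC; apply: Gf.
Qed.

End DifferentialLoci.

(** * Separation by homomorphisms to the symplectic algebra *)

Section Separation.
Variables (R : idomainType) (QinR : {rmorphism rat -> R}) (m : nat).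
Local Notation P := (symplectic R m).

Lemma brk_symplecticE (f g : P) : brk f g =
  \sum_(i < m) (partial (even_index i) f * partial (odd_index i) g
                - partial (odd_index i) f * partial (even_index i) g).
Proof. by []. Qed.

Lemma partial_natr (i : 'I_m.*2) n : partial i n%:R = 0 :> P.
Proof. by rewrite /partial -[n%:R]/(n%:R : mpoly _ _) -mpolyC_nat mderivC. Qed.

Lemma partial_horner_nat i (p : {poly P}) n :
  partial i p.[n%:R] = (map_poly (partial i) p).[n%:R].
Proof.
rewrite /map_poly horner_poly horner_coef raddf_sum; apply: eq_bigr => j _ /=.
by rewrite partialM -natrX partial_natr mulr0 addr0.
Qed.

(** Natural numbers are killed by the derivations, so brackets stay polynomial in n. *)
Lemma peval_line X (v0 v1 : X -> P) t : exists p : {poly P},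
  forall n : nat, peval (fun i => v0 i + n%:R * (v1 i - v0 i)) t = p.[n%:R].
Proof.
elim: t => /= [i||t1 [p1 E1] t2 [p2 E2]|r t [p E]|t1 [p1 E1] t2 [p2 E2]|t1 [p1
  E1] t2 [p2 E2]].
- by exists ((v0 i)%:P + 'X * (v1 i - v0 i)%:P) => n; rewrite !hornerE.
- by exists 1 => n; rewrite hornerC.
- by exists (p1 + p2) => n; rewrite hornerD E1 E2.
- by exists (r%:A%:P * p) => n; rewrite hornerCM E mulr_algl.
- by exists (p1 * p2) => n; rewrite hornerM E1 E2.
- exists (\sum_(i < m)
    (map_poly (partial (even_index i)) p1 * map_poly (partial (odd_index i)) p2
      -
     map_poly (partial (odd_index i)) p1 * map_poly (partial (even_index i))
       p2)).
  move=> n; rewrite E1 E2 brk_symplecticE horner_sum; apply: eq_bigr => i _.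
  by rewrite hornerD hornerN !hornerM !partial_horner_nat.
Qed.

Lemma natr_symplectic_neq0 n : n.+1%:R != 0 :> P.
Proof.
have [u uE] := natr_inverse m QinR n.
by apply: contra_eqN uE => /eqP ->; rewrite mulr0 eq_sym oner_eq0.
Qed.

Lemma natr_symplectic_inj : injective (fun n : nat => n%:R : P).
Proof.
move=> a b /= ab; wlog lt_ab : a b ab / (a < b)%N.
  by move=> wl; case: (ltngtP a b) => [/wl->|/wl->|].
have := natr_symplectic_neq0 (b - a).-1.
rewrite prednK ?subn_gt0 // natrB 1?ltnW //.
by rewrite ab subrr eqxx.
Qed.

Lemma poly_nat_nonroot (p : {poly P}) : p != 0 -> exists n : nat, p.[n%:R] != 0.
Proof.
move=> p0; apply: contrapT => np.
have := @max_poly_roots _ p [seq n%:R | n <- iota 0 (size p)] p0.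
rewrite size_map size_iota ltnn => h.
suff: false by []; apply: h; last by rewrite map_inj_uniq ?iota_uniq //;
  exact: natr_symplectic_inj.
apply/allP => _ /mapP[n _ ->]; rewrite rootE; apply/negPn/negP => pn.
by apply: np; exists n.
Qed.

Variables (X : Type) (F : poissonAlgType R) (x : X -> F).
Hypothesis freeF : is_free (Var P) x.

(** Identities have variables in [nat] while [X] is arbitrary; finitely many variables can be
    renamed. *)
Lemma peval_local (t : pterm R X) : exists s : seq {classic X},
  forall (A : poissonAlgType R) (w w' : X -> A), (forall i : {classic X},
    i \in s -> w i = w' i) ->
    peval w t = peval w' t.
Proof.
elim: t => /= [i||t1 [s1 E1] t2 [s2 E2]|r t [s E]|t1 [s1 E1] t2 [s2 E2]|t1 [s1
  E1] t2 [s2 E2]].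
- by exists [:: i] => A w w' ww'; apply: ww'; exact: mem_head.
- by exists [::].
2: by exists s => A w w' ww'; rewrite (E _ w w').
all: exists (s1 ++ s2) => A w w' ww';
  rewrite (E1 _ w w') ?(E2 _ w w') // => i si;
  by apply: ww'; rewrite mem_cat si ?orbT.
Qed.

Fixpoint trename V W (r : V -> W) (t : pterm R V) : pterm R W :=
  match t with
  | PVar i => PVar R (r i)
  | POne => POne
  | PAdd t1 t2 => PAdd (trename r t1) (trename r t2)
  | PScale c t1 => PScale c (trename r t1)
  | PMul t1 t2 => PMul (trename r t1) (trename r t2)
  | PBrk t1 t2 => PBrk (trename r t1) (trename r t2)
  end.

Lemma peval_rename V W (A : poissonAlgType R) (r : V -> W) (w : W -> A) t :
  peval w (trename r t) = peval (w \o r) t.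
Proof. by elim: t => //= [t1 -> t2 ->|c t ->|t1 -> t2 ->|t1 -> t2 ->]. Qed.

(** If every homomorphism to P killed f, a term for f would be an identity of P, hence of F. *)
Lemma free_separated f : f != 0 -> exists phi : {poisson F -> P}, phi f != 0.
Proof.
move=> f0; apply: contrapT => phi0.
have [t ft] := free_term (@Var_is_variety _ P) freeF f.
have [s sP] := peval_local t.
(* Generators outside [s] all share the index [size s], harmlessly since [t] depends only on [s]. *)
pose r (i : X) := index (i : {classic X}) s.
have FP : identity_of P (trename r t).
  move=> v; rewrite peval_rename.
  have [phi [phix _]] := freeF.2 P (@Var_gen _ _) (v \o r).
  rewrite -(peval_ext _ phix) -(peval_morph phi x) -ft.
  by apply/eqP; apply: contrapT => /negP phif; apply: phi0; exists phi.
have := freeF.1 _ FP (fun n => nth 0 [seq x i | i <- s] n).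
rewrite peval_rename (sP _ _ x) => [/eqP|i is_];
  first by rewrite -ft (negPf f0).
by rewrite /comp /r (nth_map (i : {classic X})) ?index_mem // nth_index.
Qed.

(** The line from phi (n = 0) to psi (n = 1) makes the values of f and g nonzero polynomials in n;
    over a domain of characteristic zero their product is nonzero at some n. *)
Lemma free_separated2 f g : f != 0 -> g != 0 ->
  exists phi : {poisson F -> P}, phi f != 0 /\ phi g != 0.
Proof.
move=> /free_separated[phi phif] /free_separated[psi psig].
have [t ft] := free_term (@Var_is_variety _ P) freeF f.
have [u gu] := free_term (@Var_is_variety _ P) freeF g.
have [p pE] := peval_line (phi \o x) (psi \o x) t.
have [q qE] := peval_line (phi \o x) (psi \o x) u.
have [n] : exists n : nat, (p * q).[n%:R] != 0.
  apply: poly_nat_nonroot; apply/mulf_neq0.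
    apply: contra_neq phif => p0; rewrite ft peval_morph.
    have := pE 0%N; rewrite p0 horner0 => <-; apply: peval_ext => i /=.
    by rewrite mul0r addr0.
  apply: contra_neq psig => q0; rewrite gu peval_morph.
  have := qE 1%N; rewrite q0 horner0 => <-; apply: peval_ext => i /=.
  by rewrite mul1r addrC subrK.
rewrite hornerM mulf_eq0 negb_or -pE -qE => /andP[tn un].
have [_ /(_ P (@Var_gen _ _) (fun i =>
  phi (x i) + n%:R * (psi (x i) - phi (x i))))] := freeF.
case=> chi [chix _]; exists chi; rewrite ft gu !peval_morph.
by rewrite !(peval_ext _ chix).
Qed.

End Separation.

(** * The Zariski topology *)

Section Zariski.
Variables (R : idomainType) (QinR : {rmorphism rat -> R}) (m : nat).
Local Notation P := (symplectic R m).
Variables (X : Type) (F : poissonAlgType R) (x : X -> F).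
Hypothesis freeF : is_free (Var P) x.
Local Notation J := {poisson F -> P}.

Lemma free_mulf_neq0 (f g : F) : f != 0 -> g != 0 -> f * g != 0.
Proof.
move=> f0 g0; have [phi [phif phig]] := free_separated2 QinR freeF f0 g0.
apply: contra_eq_neq (rmorphM phi f g) => ->.
by rewrite rmorph0 eq_sym mulf_neq0.
Qed.

(** The sets in question are nonempty, and those of f and g meet in that of f g, which is nonzero:
    they form a filter base. *)
Lemma generic_ultrafilter : exists G : set_system J, UltraFilter G /\
  forall f : F, f != 0 -> G [set phi | phi f != 0].
Proof.
pose G0 : set_system J :=
  [set A | exists2 f : F, f != 0 & [set phi : J | phi f != 0] `<=` A].
have G0F : ProperFilter G0.
  apply: Build_ProperFilter_ex.
    move=> A [f f0 fA]; have [phi phif] := free_separated freeF f0.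
    by exists phi; apply: fA.
  split.
  - by exists 1; first exact: oner_neq0.
  - move=> A B [f f0 fA] [g g0 gB]; exists (f * g); first exact: free_mulf_neq0.
    move=> phi /=; rewrite rmorphM mulf_eq0 negb_or => /andP[phif phig].
    by split; [apply: fA|apply: gB].
  - by move=> A B AB [f f0 fA]; exists f => // phi /fA/AB.
have [G [GU G0G]] := ultraFilterLemma G0F.
by exists G; split=> // f f0; apply: G0G; exists f.
Qed.

Variables (M : poissonAlgType R -> Prop) (k : nat).
Variables (E : poissonAlgType R) (z : 'I_k -> E) (D : poissonAlgType R).
Variables (iA : {poisson F -> D}) (iE : {poisson E -> D}).
Hypotheses (varM : is_variety M) (MF : M F) (freeE : is_free M z).
Hypothesis copD : is_coproduct M iA iE.
Local Notation Omega := {ffun 'I_k -> F}.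
Local Notation space := (zariski_space iA (iE \o z)).

Variable ev : Omega -> {poisson D -> F}.
Hypothesis evP : forall a, is_evaluation iA (iE \o z) a (ev a).

Lemma zero_locusE (S : set D) (a : Omega) :
  zero_locus iA (iE \o z) S a <-> forall d, S d -> ev a d = 0.
Proof.
split=> [[phi phia phiS] d Sd|eS]; last by exists (ev a).
have [chi [_ uniq]] := evaluation_exists_unique a MF freeE copD.
by rewrite (uniq _ (evP a)) -(uniq _ phia) phiS.
Qed.

(* Elements of a finite intersection of basic open sets are separated from its
   complement by a product, as F is a domain. *)
Lemma zariski_closed_separated (C : set space) (a : Omega) : closed C ->
  ~ C a ->
  exists2 d, ev a d != 0 & forall c, C c -> ev c d = 0.
Proof.
rewrite -openC => -[D' D'sub D'E] Ca.
have : (~` C) a by [].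
rewrite -D'E => -[A D'A Aa].
have AC : A `<=` ~` C by move=> b Ab; rewrite -D'E; exists A.
have [s _ sE] := D'sub _ D'A.
have {}Aa : forall S, S \in s -> ~ zero_locus iA (iE \o z) S a.
  by move: Aa; rewrite -sE.
(* Multiply elements not vanishing at [a], one from each set S. *)
have [d da dc] : exists2 d, ev a d != 0 & forall c S, S \in s ->
    zero_locus iA (iE \o z) S c -> ev c d = 0.
  have: forall S, S \in enum_fset s -> ~ zero_locus iA (iE \o z) S a by [].
  suff : forall r : seq (set D), (forall S,
    S \in r -> ~ zero_locus iA (iE \o z) S a) ->
    exists2 d, ev a d != 0 & forall c S, S \in r ->
    zero_locus iA (iE \o z) S c -> ev c d = 0 by apply.
  elim=> [_|S r IH ra]; first by exists 1; rewrite ?rmorph1 ?oner_neq0.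
  have [|d da dc] := IH; first by move=> S' S'r; apply: ra;
    rewrite inE S'r orbT.
  have [e [Se ea]] : exists e, S e /\ ev a e != 0.
    apply: contrapT => ne; apply: (ra S); first exact: mem_head.
    apply/zero_locusE => e Se; apply/eqP; apply: contrapT => /negP ea.
    by apply: ne; exists e.
  exists (e * d); first by rewrite rmorphM free_mulf_neq0.
  move=> c S'; rewrite inE => /predU1P[->|S'r] Sc; rewrite rmorphM /=.
    by move/zero_locusE: Sc => /(_ _ Se) ->; rewrite mul0r.
  by rewrite (dc _ _ S'r Sc) mulr0.
exists d => // c Cc; apply: contrapT => cd.
have : ~ A c by move=> /AC.
rewrite -sE => nA; apply: nA => S sS /= Sc; apply: cd; exact: dc sS Sc.
Qed.

Variables (G : set_system J) (o0 : Omega) (j0 : J).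
Hypothesis GU : UltraFilter G.
Local Notation coord := (fun (a : Omega) i (phi : J) => phi (a i) : P).
Local Notation T := (points o0 j0).
Local Notation dpoly := (@diff_poly R m k Omega J coord o0 j0).

(** Such d form a Poisson subalgebra, the bracket of P being polynomial in partial derivatives. It
    contains F, which gives coefficients, and the unknowns, which give coordinates. *)
Lemma evaluation_diff_poly d : dpoly (fun t : T => t.2 (ev t.1 d)).
Proof.
have cst (c : J -> P) : dpoly (fun t : T => c t.2).
  by apply: genring_coef; exists c.
pose S : set D := [set d | dpoly (fun t : T => t.2 (ev t.1 d))].
have cS : poisson_closed S.
  split=> [|a b Sa Sb|r a Sa|a b Sa Sb|a b Sa Sb]; rewrite /S /=.
  - rewrite (_ : (fun _ => _) = fun=> 1); first exact: (cst (fun=> 1)).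
    by apply/funext => t; rewrite !rmorph1.
  - rewrite (_ : (fun _ => _) = (fun t : T => t.2 (ev t.1 a)) +
      (fun t : T => t.2 (ev t.1 b))); first exact: genringD.
    by apply/funext => t; rewrite -[RHS]/(t.2 (ev t.1 a) + t.2 (ev t.1 b))
      rmorphD rmorphD.
  - rewrite (_ : (fun _ => _) = (fun _ : T => r%:A) *
      (fun t : T => t.2 (ev t.1 a))); first exact: genringM (cst (fun=> _)) Sa.
    by apply/funext => t; rewrite -[RHS]/(r%:A * t.2 (ev t.1 a)) linearZ
      linearZ mulr_algl.
  - rewrite (_ : (fun _ => _) = (fun t : T => t.2 (ev t.1 a)) *
      (fun t : T => t.2 (ev t.1 b))); first exact: genringM.
    by apply/funext => t; rewrite -[RHS]/(t.2 (ev t.1 a) * t.2 (ev t.1 b))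
      rmorphM rmorphM.
  pose p i : T -> P := fder i (fun t : T => t.2 (ev t.1 a)).
  pose q i : T -> P := fder i (fun t : T => t.2 (ev t.1 b)).
  rewrite (_ : (fun _ => _) = \sum_(i < m) (p (even_index i) * q (odd_index i)
                - p (odd_index i) * q (even_index i))).
    have Sp i : dpoly (p i) by apply: diff_poly_der.
    have Sq i : dpoly (q i) by apply: diff_poly_der.
    apply: big_ind => [|f g|i _]; first exact: (cst (fun=> 0)).
      exact: genringD.
    apply: genringD; first exact: genringM (Sp _) (Sq _).
    rewrite -mulN1r; apply: genringM (genringM (Sp _) (Sq _)).
    exact: (cst (fun=> -1)).
  by apply/funext => t; rewrite !brk_morph fct_sumE.
apply: (coproduct_ind varM copD cS) => [c|]; rewrite /S /=.
  rewrite (_ : (fun _ => _) = fun t : T => t.2 c);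
    first exact: (cst (fun phi => phi c)).
  by apply/funext => t; have [-> _] := evP t.1.
apply: (free_ind varM freeE) => [|i].
  by split=> *; rewrite ?rmorph1 ?rmorphD ?linearZ ?rmorphM ?brk_morph;
    [apply: (pc1 cS)|apply: (pcD cS)|apply: (pcZ cS)|apply: (pcM cS)|apply:
      (pc_brk cS)].
rewrite (_ : (fun _ => _) = @jet_coord R m k Omega J coord o0 j0 (i, mnm0)).
  exact: genring_var.
apply/funext => t; rewrite /jet_coord mderivm0m /=.
by have [_ /(_ i) /= ->] := evP t.1.
Qed.

End Zariski.

Theorem corollary8 (R : idomainType) (Rrad : radically_noetherian R)
    (QinR : {rmorphism rat -> R}) (m : nat) (m_gt0 : (0 < m)%N)
    (X : Type) (F : poissonAlgType R) (x : X -> F) :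
  is_free (Var (symplectic R m)) x -> equationally_noetherian F.
Proof.
move=> freeF M [varM MF _] k _ E z freeE D iA iE copD C closedC decC.
have /choice[ev evP] (a : {ffun 'I_k -> F}) :
    exists phi, is_evaluation iA (iE \o z) a phi.
  by have [phi [phia _]] := evaluation_exists_unique a MF freeE copD;
    exists phi.
have [G [GU Gne]] := generic_ultrafilter QinR freeF.
have [j0 _] := free_separated freeF (oner_neq0 F).
pose o0 : {ffun 'I_k -> F} := [ffun=> 0].
have [N NP] := diff_loci_noetherian QinR
  (fun (a : {ffun 'I_k -> F}) i (phi : {poisson F -> symplectic R m}) =>
    phi (a i))
  GU o0 j0 decC.
exists N => n Nn; apply/seteqP; split.
  by rewrite -(subnK Nn); elim: (n - N)%N => [//|i IH] a /decC; apply: IH.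
(* An equation valid on [C n] but not at a would, the vanishing ideals being equal, have its value
   at a killed by almost every homomorphism, against genericity. *)
move=> a CNa; apply: contrapT => Cna.
have [d da dC] := zariski_closed_separated QinR freeF MF freeE copD evP
  (closedC n) Cna.
have := NP n Nn; rewrite seteqP => -[+ _].
move=> /(_ (fun t => t.2 (ev t.1 d))) [].
  split; first by refine (evaluation_diff_poly varM freeE copD evP o0 j0 d).
  by move=> c Cc; apply: filterE => phi /=; rewrite (dC _ Cc) raddf0.
move=> _ /(_ a CNa) G0; apply: (@filter_not_empty _ G).
by apply: filterS2 G0 (Gne _ da) => phi /= -> /eqP.
Qed.
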